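(* Let $\mathbb F$ be a field of characteristic $3$ and let $\mu:\mathcal A\otimes\mathcal B\to\mathcal C$ be a homomorphism in $\mathsf{Rep}\,\mathsf C_3$. Pick splittings $\mathcal A=\mathcal A_0\oplus\mathcal A_1\oplus\mathcal A_2$, $\mathcal B=\mathcal B_0\oplus\mathcal B_1\oplus\mathcal B_2$, $\mathcal C=\mathcal C_0\oplus\mathcal C_1\oplus\mathcal C_2$ in which the $i$-th summand is a direct sum of copies of $V_i$, and refinements $\mathcal A=A_{\bar0}\oplus A_{\bar1}\oplus\delta(A_{\bar1})\oplus\mathcal A_2$, $\mathcal B=B_{\bar0}\oplus B_{\bar1}\oplus\delta(B_{\bar1})\oplus\mathcal B_2$, $\mathcal C=C_{\bar0}\oplus C_{\bar1}\oplus\delta(C_{\bar1})\oplus\mathcal C_2$, where $\delta=\sigma-\mathrm{id}$, $A_{\bar0}=\mathcal A_0$, $\mathcal A_1=A_{\bar1}\oplus\delta(A_{\bar1})$, and similarly for $\mathcal B$ and $\mathcal C$. Consider the vector superspaces $A=A_{\bar0}\oplus A_{\bar1}$, $B=B_{\bar0}\oplus B_{\bar1}$, $C=C_{\bar0}\oplus C_{\bar1}$, and define the homomorphism $m:A\otimes B\to C$ in $\mathsf{sVec}$ by $$m(x_{\bar0}\otimes y_{\bar0})=\mathrm{proj}_{C_{\bar0}}\mu(x_{\bar0}\otimes y_{\bar0}),\quad m(x_{\bar0}\otimes y_{\bar1})=\mathrm{proj}_{C_{\bar1}}\mu(x_{\bar0}\otimes y_{\bar1}),$$ $$m(x_{\bar1}\otimes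 y_{\bar0})=\mathrm{proj}_{C_{\bar1}}\mu(x_{\bar1}\otimes y_{\bar0}),\quad m(x_{\bar1}\otimes y_{\bar1})=\mathrm{proj}_{C_{\bar0}}\mu\bigl(x_{\bar1}\otimes\delta(y_{\bar1})\bigr)$$ for $x_{\bar0}\in A_{\bar0}$, $x_{\bar1}\in A_{\bar1}$, $y_{\bar0}\in B_{\bar0}$, $y_{\bar1}\in B_{\bar1}$, with projections relative to $\mathcal C=C_{\bar0}\oplus C_{\bar1}\oplus\delta(C_{\bar1})\oplus\mathcal C_2$. Let $\iota_A:F(A)\to\mathcal A$ be the morphism in $\mathsf{Rep}\,\mathsf C_3$ given by $\iota_A(x_{\bar0})=x_{\bar0}$, $\iota_A(x_{\bar1}\otimes v_0)=x_{\bar1}$, $\iota_A(x_{\bar1}\otimes v_1)=\delta(x_{\bar1})$, and define $\iota_B,\iota_C$ similarly (their classes are isomorphisms in $\mathsf{Ver}_3$). Then, in $\mathsf{Ver}_3$, $$[\iota_C]\circ F(m)\circ J_{A,B}=[\mu]\circ[\iota_A\otimes\iota_B]$$ as morphisms $F(A)\otimes F(B)\to\mathcal C$.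
   Context: All vector spaces are finite-dimensional over $\mathbb F$; tensor products are over $\mathbb F$. $\mathsf C_3$ is the cyclic group of order $3$ with a fixed generator $\sigma$. $\mathsf{Rep}\,\mathsf C_3$ is the symmetric tensor category of finite-dimensional representations of $\mathsf C_3$ over $\mathbb F$ (equivariant linear maps, usual tensor product, swap as braiding). Its indecomposable objects are, up to isomorphism, $V_0=\mathbb F$ (trivial), $V_1=\mathbb Fv_0\oplus\mathbb Fv_1$ with $\sigma(v_0)=v_0+v_1$, $\sigma(v_1)=v_1$, and $V_2=\mathbb Fw_0\oplus\mathbb Fw_1\oplus\mathbb Fw_2$ with $\sigma(w_0)=w_0+w_1$, $\sigma(w_1)=w_1+w_2$, $\sigma(w_2)=w_2$. A morphism $f:X\to Y$ in $\mathsf{Rep}\,\mathsf C_3$ is negligible if $\operatorname{tr}(fg)=0$ for all morphisms $g:Y\to X$. $\mathsf{Ver}_3$ is the symmetric tensor category with the same objects and tensor product as $\mathsf{Rep}\,\mathsf C_3$, with $\operatorname{Hom}_{\mathsf{Ver}_3}(X,Y)=\operatorname{Hom}_{\mathsf{Rep}\,\mathsf C_3}(X,Y)/\{\text{negligible morphisms}\}$, and with braiding the class of the swap; $[f]$ denotes the class of $f$. $\mathsf{sVec}$ is the category of vector superspaces $X=X_{\bar0}\oplus X_{\bar1}$ with parity-preserving linear maps $f=f_{\bar0}\oplus f_{\bar1}$. $F:\mathsf{sVec}\to\mathsf{Ver}_3$ is the functor $F(X)=X_{\bar0}\oplus(X_{\bar1}\otimes V_1)$ (with $\sigma$ acting trivially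 on $X_{\bar 0}$ and by $x_{\bar 1}\otimes v\mapsto x_{\bar 1}\otimes\sigma(v)$), $F(f)=[f_{\bar0}\oplus(f_{\bar1}\otimes\mathrm{id}_{V_1})]$. Its monoidal structure $J_{X,Y}:F(X)\otimes F(Y)\to F(X\otimes Y)$ is the class of the map $x_{\bar0}\otimes y_{\bar0}\mapsto x_{\bar0}\otimes y_{\bar0}$, $x_{\bar0}\otimes(y_{\bar1}\otimes v)\mapsto(x_{\bar0}\otimes y_{\bar1})\otimes v$, $(x_{\bar1}\otimes v)\otimes y_{\bar0}\mapsto(x_{\bar1}\otimes y_{\bar0})\otimes v$, $(x_{\bar1}\otimes u)\otimes(y_{\bar1}\otimes v)\mapsto\lambda(u\otimes v)\,x_{\bar1}\otimes y_{\bar1}$, where $\lambda:V_1\otimes V_1\to\mathbb F$ is given by $v_0\otimes v_1\mapsto1$, $v_1\otimes v_0\mapsto-1$, $v_0\otimes v_0,\,v_1\otimes v_1\mapsto0$. *)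

(* Defs.v *)
From HB Require Import structures.
From mathcomp Require Import all_boot all_order all_algebra.
From mathcomp Require Import boolp ring.

Set Implicit Arguments.
Unset Strict Implicit.
Unset Printing Implicit Defensive.
Import GRing.Theory passmx.
Local Open Scope ring_scope.

(* The tensor product in coordinates with respect to the bases vbasis; its
   universal property is [tens_liftE] and [tens_ext]. *)
Section Tensor.
Variable F : fieldType.
Implicit Types U V W : vectType F.

Definition tens U V : vectType F := 'M[F]_(\dim {:U}, \dim {:V}).

Definition tpure U V (u : U) (v : V) : tens U V :=
  \matrix_(i, j) (coord (vbasis {:U}) i u * coord (vbasis {:V}) j v).

(* The linear map x (x) y |-> b x y; meaningful only when b is bilinear. *)
Definition tens_lift U V W (b : U -> V -> W) : 'Hom(tens U V, W) :=
  linfun (fun t : 'M[F]_(\dim {:U}, \dim {:V}) => \sum_i \sum_j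
            t i j *: b (vbasis {:U})`_i (vbasis {:V})`_j).

Definition bilin U V W (b : U -> V -> W) : Prop :=
  (forall x, linear (b x)) /\ (forall y, linear (b^~ y)).

Lemma linfunE U V (f : U -> V) : linear f -> linfun f =1 f.
Proof.
move=> lf; pose flM := GRing.isLinear.Build F _ _ _ f lf.
pose fL : {linear _ -> _} := HB.pack f flM.
exact: (lfunE fL).
Qed.

Lemma tens_lift_raw U V W (b : U -> V -> W) (t : 'M[F]_(\dim {:U}, \dim {:V})) :
  tens_lift b t = \sum_i \sum_j
            t i j *: b (vbasis {:U})`_i (vbasis {:V})`_j.
Proof.
apply: linfunE => a x y.
rewrite scaler_sumr -big_split; apply: eq_bigr => i _ /=.
rewrite scaler_sumr -big_split; apply: eq_bigr => j _ /=.
by rewrite !mxE scalerDl scalerA.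
Qed.

Lemma lin_sum_scale U W (f : U -> W) (I : finType) (a : I -> F) (e : I -> U) :
  linear f -> f (\sum_i a i *: e i) = \sum_i a i *: f (e i).
Proof.
move=> lf; rewrite -(linfunE lf) linear_sum; apply: eq_bigr => i _.
by rewrite linearZ /= linfunE.
Qed.

Lemma tens_liftE U V W (b : U -> V -> W) : bilin b ->
  forall x y, tens_lift b (tpure x y) = b x y.
Proof.
case=> lb1 lb2 x y; rewrite tens_lift_raw.
rewrite {2}(coord_vbasis (memvf x)) (lin_sum_scale _ _ (lb2 y)).
apply: eq_bigr => i _.
rewrite {2}(coord_vbasis (memvf y)) (lin_sum_scale _ _ (lb1 _)) scaler_sumr.
by apply: eq_bigr => j _; rewrite scalerA mxE.
Qed.

Lemma tpure_bilin U V : bilin (@tpure U V).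
Proof.
split=> [x a u v|y a u v]; apply/matrixP => i j; rewrite !mxE linearP /=.
  by rewrite mulrDr mulrCA.
by rewrite mulrDl mulrA.
Qed.

Lemma tens_ext U V W (f g : 'Hom(tens U V, W)) :
  (forall x y, f (tpure x y) = g (tpure x y)) -> f = g.
Proof.
move=> fg; apply/lfunP => t.
have -> : t = \sum_i \sum_j (t : 'M__) i j
    *: tpure (vbasis {:U})`_i (vbasis {:V})`_j.
  rewrite {1}[t]matrix_sum_delta; apply: eq_bigr => i _; apply: eq_bigr => j _.
  apply/matrixP => k l; rewrite !mxE; congr (_ * _).
  rewrite !coord_free ?(basis_free (vbasisP _)) //.
  by rewrite -natrM mulnb ![_ == k]eq_sym ![_ == l]eq_sym.
rewrite !linear_sum; apply: eq_bigr => i _.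
rewrite !linear_sum; apply: eq_bigr => j _.
by rewrite !linearZ /= fg.
Qed.

Lemma tens_ind U V (P : tens U V -> Prop) :
  P 0 -> (forall s t, P s -> P t -> P (s + t)) ->
  (forall x y, P (tpure x y)) -> forall t, P t.
Proof.
move=> P0 PD Pp t; rewrite [t]matrix_sum_delta.
apply: big_ind => // i _; apply: big_ind => // j _.
have -> : t i j *: delta_mx i j =
    tpure (t i j *: (vbasis {:U})`_i) (vbasis {:V})`_j; last exact: Pp.
apply/matrixP => k l; rewrite !mxE linearZ /=.
rewrite !coord_free ?(basis_free (vbasisP _)) // -mulrA -natrM mulnb.
by rewrite ![_ == k]eq_sym ![_ == l]eq_sym.
Qed.

Lemma tens_lift_par (P U V W : vectType F) (b : P -> U -> V -> W) (t : tens U V) :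
  (forall x y, linear (fun p : P => b p x y)) ->
  linear (fun p : P => tens_lift (b p) t).
Proof.
move=> lb a p q; rewrite !tens_lift_raw scaler_sumr -big_split.
apply: eq_bigr => i _ /=; rewrite scaler_sumr -big_split.
apply: eq_bigr => j _ /=.
by rewrite lb scalerDr !scalerA mulrC.
Qed.

Definition tens_map U V U' V' (f : 'Hom(U, U')) (g : 'Hom(V, V')) :
    'Hom(tens U V, tens U' V') :=
  tens_lift (fun x y => tpure (f x) (g y)).

Lemma bilin_comp U V U' V' W (b : U' -> V' -> W) (f : 'Hom(U, U'))
    (g : 'Hom(V, V')) : bilin b -> bilin (fun x y => b (f x) (g y)).
Proof.
by case=> lb1 lb2; split=> [x a u v|y a u v]; rewrite linearP ?lb1 ?lb2.
Qed.

Lemma tens_mapE U V U' V' (f : 'Hom(U, U')) (g : 'Hom(V, V')) x y :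
  tens_map f g (tpure x y) = tpure (f x) (g y).
Proof. by rewrite (tens_liftE (bilin_comp f g (tpure_bilin U' V'))). Qed.

Definition sum_map U V U' V' (f : 'Hom(U, U')) (g : 'Hom(V, V')) :
    'Hom((U * V)%type, (U' * V')%type) :=
  linfun (fun p : U * V => (f p.1, g p.2)).

Lemma sum_mapE U V U' V' (f : 'Hom(U, U')) (g : 'Hom(V, V')) p :
  sum_map f g p = (f p.1, g p.2).
Proof. by apply: linfunE => a u v; rewrite /= !linearP. Qed.

Definition trace V (f : 'End(V)) : F :=
  \tr (mxof (vbasis {:V}) (vbasis {:V}) f).

Lemma trace0 V : trace (0 : 'End(V)) = 0.
Proof. by rewrite /trace !linear0. Qed.

Lemma traceB V (f g : 'End(V)) : trace (f - g) = trace f - trace g.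
Proof. by rewrite /trace !linearB. Qed.

Lemma trace_mulC U V (f : 'Hom(U, V)) (g : 'Hom(V, U)) :
  trace (f \o g)%VF = trace (g \o f)%VF.
Proof.
rewrite /trace (mxof_comp _ _ (vbasisP {:U})) (mxof_comp _ _ (vbasisP {:V})).
exact: mxtrace_mulC.
Qed.

End Tensor.

Notation "u \ox v" := (tpure u v) (at level 40, left associativity) : ring_scope.

(* C_3 is the additive group 'Z_3, with generator 1. *)
Record rep (F : fieldType) := Rep {
  rep_space :> vectType F;
  rep_act : 'Z_3 -> 'End(rep_space);
  rep_act0 : rep_act 0 = \1%VF;
  rep_actD : forall g h : 'Z_3,
    rep_act (g + h) = (rep_act g \o rep_act h)%VF }.

Section RepCategory.
Variable F : fieldType.
Implicit Types X Y Z : rep F.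

Definition sigma X : 'End(X) := rep_act X 1.

Definition delta X : 'End(X) := sigma X - \1%VF.

Definition equivariant X Y : {pred 'Hom(X, Y)} :=
  fun f => [forall g, (f \o rep_act X g == rep_act Y g \o f)%VF].
Arguments equivariant : clear implicits.

Lemma equivariantP X Y (f : 'Hom(X, Y)) :
  reflect (forall g x, f (rep_act X g x) = rep_act Y g (f x))
          (f \in equivariant X Y).
Proof.
apply: (iffP forallP) => [H g x|H g].
  by have /eqP/lfunP/(_ x) := H g; rewrite !comp_lfunE.
by apply/eqP/lfunP => x; rewrite !comp_lfunE.
Qed.

Fact equivariant_zmod X Y : zmod_closed (@equivariant X Y).
Proof.
split=> [|f g /equivariantP Hf /equivariantP Hg]; apply/equivariantP => h x.
  by rewrite !zero_lfunE linear0.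
by rewrite !(add_lfunE, opp_lfunE) Hf Hg linearB.
Qed.
HB.instance Definition _ X Y :=
  GRing.isZmodClosed.Build 'Hom(X, Y) (@equivariant X Y) (equivariant_zmod X Y).

Record repHom X Y := RepHom {
  repHom_val :> 'Hom(X, Y);
  repHomP : repHom_val \in equivariant X Y }.

HB.instance Definition _ X Y := [isSub for @repHom_val X Y].
HB.instance Definition _ X Y := [Choice of repHom X Y by <:].
HB.instance Definition _ X Y := [SubChoice_isSubZmodule of repHom X Y by <:].

Lemma repHomE X Y (f : repHom X Y) g x : f (rep_act X g x) = rep_act Y g (f x).
Proof. by apply: (equivariantP _ (repHomP f)). Qed.

Fact repId_subproof X : \1%VF \in equivariant X X.
Proof. by apply/equivariantP => g x; rewrite !id_lfunE. Qed.
Definition repId X : repHom X X := RepHom (repId_subproof X).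

Fact repComp_subproof X Y Z (f : repHom Y Z) (g : repHom X Y) :
  (f \o g)%VF \in equivariant X Z.
Proof. by apply/equivariantP => h x; rewrite !comp_lfunE !repHomE. Qed.
Definition repComp X Y Z (f : repHom Y Z) (g : repHom X Y) : repHom X Z :=
  RepHom (repComp_subproof f g).

Fact rep_triv_D (U : vectType F) : \1%VF = (\1 \o \1 : 'End(U))%VF.
Proof. by rewrite comp_lfun1l. Qed.
Definition rep_triv (U : vectType F) : rep F :=
  @Rep F U (fun=> \1%VF) erefl (fun _ _ => rep_triv_D U).

Fact rep_sum_0 X Y : sum_map (rep_act X 0) (rep_act Y 0) = \1%VF.
Proof.
by apply/lfunP => -[x y]; rewrite sum_mapE !rep_act0 !id_lfunE.
Qed.
Fact rep_sum_D X Y (g h : 'Z_3) :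
  sum_map (rep_act X (g + h)) (rep_act Y (g + h)) =
  (sum_map (rep_act X g) (rep_act Y g) \o sum_map (rep_act X h) (rep_act Y h))%VF.
Proof.
by apply/lfunP => -[x y]; rewrite comp_lfunE !sum_mapE !rep_actD !comp_lfunE.
Qed.
Definition rep_sum X Y : rep F :=
  @Rep F (X * Y)%type (fun g => sum_map (rep_act X g) (rep_act Y g))
    (rep_sum_0 X Y) (@rep_sum_D X Y).

Fact rep_tens_0 X Y : tens_map (rep_act X 0) (rep_act Y 0) = \1%VF.
Proof.
by apply/tens_ext => x y; rewrite tens_mapE !rep_act0 !id_lfunE.
Qed.
Fact rep_tens_D X Y (g h : 'Z_3) :
  tens_map (rep_act X (g + h)) (rep_act Y (g + h)) =
  (tens_map (rep_act X g) (rep_act Y g)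
     \o tens_map (rep_act X h) (rep_act Y h))%VF.
Proof.
by apply/tens_ext => x y; rewrite comp_lfunE !tens_mapE !rep_actD !comp_lfunE.
Qed.
Definition rep_tens X Y : rep F :=
  @Rep F (tens X Y) (fun g => tens_map (rep_act X g) (rep_act Y g))
    (rep_tens_0 X Y) (@rep_tens_D X Y).

Definition copies_map (n : nat) (U : vectType F) (f : 'End(U)) :
    'End({ffun 'I_n -> U}) :=
  linfun (fun t : {ffun 'I_n -> U} => [ffun i => f (t i)]).
Lemma copies_mapE n (U : vectType F) (f : 'End(U)) t :
  copies_map n f t = [ffun i => f (t i)].
Proof.
by apply: linfunE => a u v; apply/ffunP => i; rewrite !ffunE linearP.
Qed.
Fact rep_copies_0 n X : copies_map n (rep_act X 0) = \1%VF.
Proof.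
apply/lfunP => t; rewrite copies_mapE id_lfunE rep_act0.
by apply/ffunP => i; rewrite ffunE id_lfunE.
Qed.
Fact rep_copies_D n X (g h : 'Z_3) :
  copies_map n (rep_act X (g + h)) =
  (copies_map n (rep_act X g) \o copies_map n (rep_act X h))%VF.
Proof.
apply/lfunP => t; rewrite comp_lfunE !copies_mapE.
by apply/ffunP => i; rewrite !ffunE rep_actD comp_lfunE.
Qed.
Definition rep_copies n X : rep F :=
  @Rep F {ffun 'I_n -> X} (fun g => copies_map n (rep_act X g))
    (rep_copies_0 n X) (@rep_copies_D n X).

Fact repHom_sum_subproof X Y X' Y' (f : repHom X X') (g : repHom Y Y') :
  sum_map f g \in equivariant (rep_sum X Y) (rep_sum X' Y').
Proof. by apply/equivariantP => h p; rewrite !sum_mapE /= !repHomE. Qed.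
Definition repHom_sum X Y X' Y' (f : repHom X X') (g : repHom Y Y') :
    repHom (rep_sum X Y) (rep_sum X' Y') :=
  RepHom (repHom_sum_subproof f g).

Fact repHom_tens_subproof X Y X' Y' (f : repHom X X') (g : repHom Y Y') :
  tens_map f g \in equivariant (rep_tens X Y) (rep_tens X' Y').
Proof.
apply/forallP => h; apply/eqP/tens_ext => x y.
by rewrite !comp_lfunE !tens_mapE !repHomE.
Qed.
Definition repHom_tens X Y X' Y' (f : repHom X X') (g : repHom Y Y') :
    repHom (rep_tens X Y) (rep_tens X' Y') :=
  RepHom (repHom_tens_subproof f g).

Fact repHom_triv_subproof (U V : vectType F) (f : 'Hom(U, V)) :
  f \in equivariant (rep_triv U) (rep_triv V).
Proof. by apply/equivariantP => g x; rewrite !id_lfunE. Qed.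
Definition repHom_triv (U V : vectType F) (f : 'Hom(U, V)) :
    repHom (rep_triv U) (rep_triv V) :=
  RepHom (repHom_triv_subproof f).

Lemma equivariant_sigma X Y (f : 'Hom(X, Y)) :
  (forall x, f (sigma X x) = sigma Y (f x)) -> f \in equivariant X Y.
Proof.
move=> Hf; apply/equivariantP => g; rewrite -[g]natr_Zp.
elim: (nat_of_ord g) => [|n IH] x; first by rewrite !rep_act0 !id_lfunE.
by rewrite -[n.+1]addn1 [_%:R]natrD !rep_actD !comp_lfunE IH Hf.
Qed.

End RepCategory.
Arguments equivariant {F} X Y f.
Arguments sigma {F} X.
Arguments delta {F} X.

Section Ver3.
Variable F : fieldType.
Implicit Types X Y Z : rep F.

Definition negligible X Y : {pred repHom X Y} :=
  fun f => `[< forall g : repHom Y X, trace (f \o g)%VF = 0 >].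
Arguments negligible : clear implicits.

Lemma negligibleP X Y (f : repHom X Y) :
  (forall g : repHom Y X, trace (f \o g)%VF = 0) <-> f \in negligible X Y.
Proof. by split=> [H|/asboolP//]; apply/asboolP. Qed.

Fact negligible_zmod X Y : zmod_closed (@negligible X Y).
Proof.
split=> [|f g /negligibleP Hf /negligibleP Hg]; apply/negligibleP => h.
  by rewrite comp_lfun0l trace0.
rewrite -[(_ \o h)%VF]/((repHom_val f - repHom_val g) \o h)%VF comp_lfunDl.
by rewrite comp_lfunNl traceB Hf Hg subr0.
Qed.
HB.instance Definition _ X Y :=
  GRing.isZmodClosed.Build (repHom X Y) (@negligible X Y) (negligible_zmod X Y).

Definition verHom X Y : Type := Quotient.quot (@negligible X Y).

Definition verClass X Y (f : repHom X Y) : verHom X Y :=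
  (\pi_(Quotient.quot (@negligible X Y)) f)%qT.

Definition verRepr X Y (a : verHom X Y) : repHom X Y :=
  repr (a : Quotient.quot (@negligible X Y)).

Lemma verClassP X Y (f g : repHom X Y) :
  verClass f = verClass g <-> f - g \in negligible X Y.
Proof. by split=> [/eqmodP|H]; [|apply/eqmodP]. Qed.

Lemma verReprK X Y (a : verHom X Y) : verClass (verRepr a) = a.
Proof. exact: reprK. Qed.

(* Independent of the chosen representatives, by [verCompE]. *)
Definition verComp X Y Z (a : verHom Y Z) (b : verHom X Y) : verHom X Z :=
  verClass (repComp (verRepr a) (verRepr b)).

Lemma negligible_compl X Y Z (f : repHom Y Z) (g : repHom X Y) :
  f \in negligible Y Z -> repComp f g \in negligible X Z.
Proof.
move=> /negligibleP Hf; apply/negligibleP => h /=.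
by rewrite -comp_lfunA -[(g \o h)%VF]/(repHom_val (repComp g h)) Hf.
Qed.

Lemma negligible_compr X Y Z (f : repHom Y Z) (g : repHom X Y) :
  g \in negligible X Y -> repComp f g \in negligible X Z.
Proof.
move=> /negligibleP Hg; apply/negligibleP => h /=.
rewrite -comp_lfunA trace_mulC -comp_lfunA.
by rewrite -[(h \o f)%VF]/(repHom_val (repComp h f)) Hg.
Qed.

Lemma verCompE X Y Z (f : repHom Y Z) (g : repHom X Y) :
  verComp (verClass f) (verClass g) = verClass (repComp f g).
Proof.
apply/verClassP.
set f' := verRepr _; set g' := verRepr _.
have Hf : f' - f \in negligible Y Z by apply/verClassP/verReprK.
have Hg : g' - g \in negligible X Y by apply/verClassP/verReprK.
have -> : repComp f' g' - repComp f g =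
          repComp (f' - f) g' + repComp f (g' - g).
  apply/val_inj/lfunP => x /=.
  by rewrite !(add_lfunE, opp_lfunE, comp_lfunE) linearB /= addrA subrK.
by apply: rpredD; [apply: negligible_compl|apply: negligible_compr].
Qed.

End Ver3.
Arguments negligible {F} X Y f.

Section Indecomposables.
Variable F : fieldType.
Hypothesis hF : 3%N \in [pchar F].

(* Acting on row vectors: e_i |-> e_i + e_(i+1), and e_n |-> e_n. *)
Definition jordan n : 'M[F]_n.+1 :=
  \matrix_(i, j) ((j == i :> nat) || (j == i.+1 :> nat))%:R.

Lemma jordan3 n : (n < 3)%N -> jordan n ^+ 3 = 1.
Proof.
have e3 : 1 + 1 + 1 = 0 :> F by rewrite -(pcharf0 hF) !mulrS addr0 addrA.
case: n => [|[|[|//]]] _; apply/matrixP => -[[|[|[|//]]] ?] -[[|[|[|//]]] ?];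
  by rewrite !exprS expr0 mulr1; do ![rewrite !(mxE, big_ord_recl, big_ord0) /=];
     rewrite ?(mulr0, mul0r, mulr1, mul1r, addr0, add0r) ?addrA ?e3.
Qed.

Definition jordan_act n (g : 'Z_3) : 'End('rV[F]_n.+1) :=
  linfun (mulmxr (jordan n ^+ g)).

Lemma jordan_actE n g v : jordan_act n g v = v *m (jordan n ^+ g).
Proof. by rewrite lfunE. Qed.

Fact jordan_act0 n : jordan_act n 0 = \1%VF.
Proof. by apply/lfunP => v; rewrite jordan_actE id_lfunE mulmx1. Qed.

Fact jordan_actD n (hn : (n < 3)%N) (g h : 'Z_3) :
  jordan_act n (g + h) = (jordan_act n g \o jordan_act n h)%VF.
Proof.
apply/lfunP => v; rewrite comp_lfunE !jordan_actE -mulmxA.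
congr (_ *m _); rewrite mulmxE -exprD addnC.
by rewrite /= expr_mod // jordan3.
Qed.

Definition Vrep n (hn : (n < 3)%N) : rep F :=
  @Rep F 'rV[F]_n.+1 (jordan_act n) (jordan_act0 n) (jordan_actD hn).

Definition V1 : rep F := Vrep (isT : (1 < 3)%N).
Definition v0 : V1 := delta_mx 0 0 : 'rV[F]_2.
Definition v1 : V1 := delta_mx 0 1 : 'rV[F]_2.

(* Coordinates with respect to v0, v1. *)
Definition c0 (v : V1) : F := (v : 'rV[F]_2) 0 0.
Definition c1 (v : V1) : F := (v : 'rV[F]_2) 0 1.

Lemma V1_eta v : v = c0 v *: v0 + c1 v *: v1.
Proof.
apply/rowP => i; rewrite !mxE /=.
by case: i => [[|[|//]] Hi]; rewrite ?mulr0 ?mulr1 ?addr0 ?add0r;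
  congr (v _ _); apply: val_inj.
Qed.

Lemma sigma_v0 : sigma V1 v0 = v0 + v1.
Proof.
rewrite /sigma jordan_actE expr1 -rowE; apply/rowP => i; rewrite !mxE /=.
by case: i => [[|[|//]] Hi]; rewrite ?addr0 ?add0r.
Qed.

Lemma sigma_v1 : sigma V1 v1 = v1.
Proof.
rewrite /sigma jordan_actE expr1 -rowE; apply/rowP => i; rewrite !mxE /=.
by case: i => [[|[|//]] Hi].
Qed.


Lemma c0_linear : linear (c0 : V1 -> F^o).
Proof. by move=> a u v; rewrite /c0 !mxE. Qed.

Lemma c1_linear : linear (c1 : V1 -> F^o).
Proof. by move=> a u v; rewrite /c1 !mxE. Qed.

Lemma c0_sigma v : c0 (sigma V1 v) = c0 v.
Proof.
rewrite {1}[v]V1_eta linearD !linearZ /= sigma_v0 sigma_v1.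
by rewrite /c0 !mxE /=  !(mulr0, mulr1, addr0).
Qed.

Lemma c1_sigma v : c1 (sigma V1 v) = c0 v + c1 v.
Proof.
rewrite {1}[v]V1_eta linearD !linearZ /= sigma_v0 sigma_v1.
by rewrite /c1 /c0 !mxE /=  !(mulr0, mulr1, addr0, add0r).
Qed.

Definition lam : 'Hom(tens V1 V1, F^o) :=
  tens_lift (fun u v : V1 => c0 u * c1 v - c1 u * c0 v : F^o).

Lemma lamE u v : lam (u \ox v) = c0 u * c1 v - c1 u * c0 v.
Proof.
apply: (tens_liftE (W := F^o)).
split=> [x a y z|y a x z]; rewrite c0_linear c1_linear /GRing.scale /=; ring.
Qed.

Lemma lam_basis : [/\ lam (v0 \ox v1) = 1, lam (v1 \ox v0) = -1,
  lam (v0 \ox v0) = 0 & lam (v1 \ox v1) = 0].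
Proof.
rewrite !lamE /c0 /c1 !mxE /=.
by split; rewrite ?(mulr0, mulr1, mul0r, subr0, sub0r, oppr0).
Qed.

Lemma lam_sigma u v : lam (sigma V1 u \ox sigma V1 v) = lam (u \ox v).
Proof. by rewrite !lamE !c0_sigma !c1_sigma; ring. Qed.

End Indecomposables.

Record superspace (F : fieldType) := SuperSpace {
  sv0 : vectType F;
  sv1 : vectType F }.

Record superHom (F : fieldType) (X Y : superspace F) := SuperHom {
  sh0 : 'Hom(sv0 X, sv0 Y);
  sh1 : 'Hom(sv1 X, sv1 Y) }.

Definition stens (F : fieldType) (X Y : superspace F) : superspace F :=
  SuperSpace (tens (sv0 X) (sv0 Y) * tens (sv1 X) (sv1 Y))%type
             (tens (sv0 X) (sv1 Y) * tens (sv1 X) (sv0 Y))%type.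

Section Functor.
Variables (F : fieldType) (hF : 3%N \in [pchar F]).
Implicit Types X Y : superspace F.
Local Notation V1 := (V1 hF).
Local Notation lam := (lam hF).

Definition Fobj X : rep F :=
  rep_sum (rep_triv (sv0 X)) (rep_tens (rep_triv (sv1 X)) V1).

Definition Frep X Y (f : superHom X Y) : repHom (Fobj X) (Fobj Y) :=
  repHom_sum (repHom_triv (sh0 f))
             (repHom_tens (repHom_triv (sh1 f)) (repId V1)).

Definition Fmor X Y (f : superHom X Y) : verHom (Fobj X) (Fobj Y) :=
  verClass (Frep f).

Section Monoidal.
Variables X Y : superspace F.

(* (x (x) u, y (x) v) |-> lam (u (x) v) x (x) y *)
Definition Jlam (t : tens (sv1 X) V1) (s : tens (sv1 Y) V1) :
    tens (sv1 X) (sv1 Y) :=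
  tens_lift (fun x u =>
    tens_lift (fun y v => (lam (u \ox v) : F) *: (x \ox y)) s) t.

(* (x, y (x) v) |-> (x (x) y) (x) v *)
Definition Jl (x : sv0 X) (s : tens (sv1 Y) V1) :
    tens (sv1 (stens X Y)) V1 :=
  tens_lift (fun y v => ((x \ox y, 0) : sv1 (stens X Y)) \ox v) s.

(* (x (x) v, y) |-> (x (x) y) (x) v *)
Definition Jr (t : tens (sv1 X) V1) (y : sv0 Y) :
    tens (sv1 (stens X Y)) V1 :=
  tens_lift (fun x v => ((0, x \ox y) : sv1 (stens X Y)) \ox v) t.

Definition Jlin :
    'Hom(rep_tens (Fobj X) (Fobj Y), Fobj (stens X Y)) :=
  tens_lift (fun (p : Fobj X) (q : Fobj Y) =>
    ((p.1 \ox q.1, Jlam p.2 q.2), Jl p.1 q.2 + Jr p.2 q.1)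
      : Fobj (stens X Y)).


Let Jb (x : sv1 X) (u : V1) (y : sv1 Y) (v : V1) : tens (sv1 X) (sv1 Y) :=
  (lam (u \ox v) : F) *: (x \ox y).

Let tl (U V : vectType F) (x : U) : linear (tpure x : V -> _).
Proof. exact: (tpure_bilin U V).1. Qed.
Let tr (U V : vectType F) (y : V) : linear ((@tpure F U V)^~ y).
Proof. exact: (tpure_bilin U V).2. Qed.

Let Jb_bilin x u : bilin (Jb x u).
Proof.
split=> [y a v w|v a y z]; rewrite /Jb.
  by rewrite tl linearP /= scalerDl scalerA.
by rewrite tl scalerDr !scalerA mulrC.
Qed.

Let Jb_linx u y v : linear (fun x => Jb x u y v).
Proof. by move=> a x z; rewrite /Jb tr scalerDr !scalerA mulrC. Qed.

Let Jb_linu x y v : linear (fun u => Jb x u y v).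
Proof. by move=> a u w; rewrite /Jb tr linearP /= scalerDl scalerA. Qed.

Lemma JlamE x u y v :
  Jlam (x \ox u) (y \ox v) = (lam (u \ox v) : F) *: (x \ox y).
Proof.
pose b x u := tens_lift (Jb x u) (y \ox v).
have bb : bilin b.
  split=> [z|w]; first by apply: (@tens_lift_par _ _ _ _ _ (fun u => Jb z u)).
  by apply: (@tens_lift_par _ _ _ _ _ (fun x => Jb x w)).
by rewrite [LHS](tens_liftE bb) /b (tens_liftE (Jb_bilin x u)).
Qed.

Lemma JlE x y v :
  Jl x (y \ox v) = ((x \ox y, 0) : sv1 (stens X Y)) \ox v.
Proof.
rewrite /Jl tens_liftE //; split=> [z|w] a y1 y2; first by rewrite tl.
by rewrite -tr tl; congr (_ \ox _); congr pair; rewrite /= scaler0 addr0.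
Qed.

Lemma JrE x v y :
  Jr (x \ox v) y = ((0, x \ox y) : sv1 (stens X Y)) \ox v.
Proof.
rewrite /Jr tens_liftE //; split=> [z|w] a y1 y2; first by rewrite tl.
by rewrite -tr; congr (_ \ox _); rewrite tr; congr pair; rewrite /= scaler0 addr0.
Qed.

Lemma Jlam_linl s : linear (Jlam^~ s).
Proof. by move=> a t u; rewrite /Jlam linearP. Qed.

Lemma Jlam_linr t : linear (Jlam t).
Proof. by apply: tens_lift_par => x u a s s'; rewrite linearP. Qed.

Lemma Jl_linl s : linear (Jl^~ s).
Proof.
apply: tens_lift_par => y v a x1 x2; rewrite -tr; congr (_ \ox _).
by rewrite tr; congr pair; rewrite /= scaler0 addr0.
Qed.

Lemma Jl_linr x : linear (Jl x).
Proof. by move=> a t u; rewrite /Jl linearP. Qed.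

Lemma Jr_linl y : linear (Jr^~ y).
Proof. by move=> a t u; rewrite /Jr linearP. Qed.

Lemma Jr_linr t : linear (Jr t).
Proof.
apply: tens_lift_par => x v a y1 y2; rewrite -tr; congr (_ \ox _).
by rewrite tl; congr pair; rewrite /= scaler0 addr0.
Qed.

Lemma JlinE (p : Fobj X) (q : Fobj Y) :
  Jlin (p \ox q) = ((p.1 \ox q.1, Jlam p.2 q.2), Jl p.1 q.2 + Jr p.2 q.1).
Proof.
apply: tens_liftE; split=> [{}p a q1 q2|{}q a p1 p2].
  rewrite /= tl Jlam_linr Jl_linr Jr_linr; congr pair.
  by rewrite /= scalerDr addrACA.
rewrite /= tr Jlam_linl Jl_linl Jr_linl; congr pair.
by rewrite /= scalerDr addrACA.
Qed.

Let linD (U V : vectType F) (f : U -> V) : linear f ->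
  forall x y, f (x + y) = f x + f y.
Proof. by move=> lf x y; rewrite -!(linfunE lf) linearD. Qed.
Let lin0 (U V : vectType F) (f : U -> V) : linear f -> f 0 = 0.
Proof. by move=> lf; rewrite -(linfunE lf) linear0. Qed.

Let T (U : vectType F) : 'End(tens U V1) :=
  tens_map \1%VF (sigma V1).

Lemma Jlam_sigma t s : Jlam (T _ t) (T _ s) = Jlam t s.
Proof.
elim/tens_ind: t => [|t t' IH IH'|x u].
- by rewrite !linear0 !(lin0 (Jlam_linl _)).
- by rewrite !linearD !(linD (Jlam_linl _)) IH IH'.
elim/tens_ind: s => [|t t' IH IH'|y v].
- by rewrite !linear0 !(lin0 (Jlam_linr _)).
- by rewrite !linearD !(linD (Jlam_linr _)) IH IH'.
by rewrite !tens_mapE !JlamE lam_sigma !id_lfunE.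
Qed.

Lemma Jl_sigma x s : Jl x (T _ s) = T _ (Jl x s).
Proof.
elim/tens_ind: s => [|t t' IH IH'|y v].
- by rewrite !(linear0, lin0 (Jl_linr _)).
- by rewrite !(linearD, linD (Jl_linr _)) IH IH'.
by rewrite !(tens_mapE, JlE) !id_lfunE.
Qed.

Lemma Jr_sigma t y : Jr (T _ t) y = T _ (Jr t y).
Proof.
elim/tens_ind: t => [|t t' IH IH'|x v].
- by rewrite !(linear0, lin0 (Jr_linl _)).
- by rewrite !(linearD, linD (Jr_linl _)) IH IH'.
by rewrite !(tens_mapE, JrE) !id_lfunE.
Qed.

Fact Jrep_subproof :
  Jlin \in equivariant (rep_tens (Fobj X) (Fobj Y)) (Fobj (stens X Y)).
Proof.
apply: equivariant_sigma => t.
rewrite -[LHS]comp_lfunE -[RHS]comp_lfunE.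
move: t; apply/lfunP/tens_ext => p q.
rewrite !comp_lfunE tens_mapE !JlinE !sum_mapE /= !id_lfunE.
by rewrite Jlam_sigma Jl_sigma Jr_sigma linearD.
Qed.
Definition Jrep : repHom (rep_tens (Fobj X) (Fobj Y)) (Fobj (stens X Y)) :=
  RepHom Jrep_subproof.

Definition Jmor : verHom (rep_tens (Fobj X) (Fobj Y)) (Fobj (stens X Y)) :=
  verClass Jrep.

End Monoidal.
End Functor.

Section Splittings.
Variables (F : fieldType) (hF : 3%N \in [pchar F]).
Implicit Types X : rep F.

Definition sum_of_copies X n (hn : (n < 3)%N) (U : {vspace X}) : Prop :=
  exists k (f : repHom (rep_copies k (Vrep hF hn)) X),
    lker f = 0%VS /\ limg f = U.

Record splitting X := Splitting {
  spl0 : {vspace X};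
  spl1 : {vspace X};
  spl2 : {vspace X};
  spl_odd : {vspace X};
  spl0P : sum_of_copies (isT : (0 < 3)%N) spl0;
  spl1P : sum_of_copies (isT : (1 < 3)%N) spl1;
  spl2P : sum_of_copies (isT : (2 < 3)%N) spl2;
  spl_full : (spl0 + spl1 + spl2 = fullv)%VS;
  spl_direct : directv (spl0 + spl1 + spl2);
  spl1_full : (spl_odd + delta X @: spl_odd = spl1)%VS;
  spl1_direct : directv (spl_odd + delta X @: spl_odd) }.

Definition sspace X (S : splitting X) : superspace F :=
  SuperSpace (subvs_of (spl0 S)) (subvs_of (spl_odd S)).

(* proj0 and proj1 project onto the first and second summands of
   X = spl0 + spl_odd + delta(spl_odd) + spl2, see [proj_summands]. *)
Definition proj0 X (S : splitting X) : 'Hom(X, sv0 (sspace S)) :=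
  linfun (fun x : X => vsproj (spl0 S)
    (daddv_pi (spl0 S) (spl_odd S + delta X @: spl_odd S + spl2 S) x)).

Definition proj1 X (S : splitting X) : 'Hom(X, sv1 (sspace S)) :=
  linfun (fun x : X => vsproj (spl_odd S)
    (daddv_pi (spl_odd S) (spl0 S + delta X @: spl_odd S + spl2 S) x)).

Definition iota_lin X (S : splitting X) : 'Hom(Fobj hF (sspace S), X) :=
  linfun (fun p : Fobj hF (sspace S) => vsval p.1 +
    tens_lift (fun (x : sv1 (sspace S)) (v : V1 hF) =>
      c0 v *: vsval x + c1 v *: delta X (vsval x)) p.2).

Lemma proj0E X (S : splitting X) x :
  vsval (proj0 S x) =
  daddv_pi (spl0 S) (spl_odd S + delta X @: spl_odd S + spl2 S) x.
Proof.
rewrite linfunE ?vsprojK ?memv_pi // => a u v.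
by rewrite linearP /= linearP.
Qed.

Lemma proj1E X (S : splitting X) x :
  vsval (proj1 S x) =
  daddv_pi (spl_odd S) (spl0 S + delta X @: spl_odd S + spl2 S) x.
Proof.
rewrite linfunE ?vsprojK ?memv_pi // => a u v.
by rewrite linearP /= linearP.
Qed.

Lemma daddv_pi_addE (V : vectType F) (U W : {vspace V}) u w :
  (U :&: W = 0)%VS -> u \in U -> w \in W -> daddv_pi U W (u + w) = u.
Proof.
move=> UW0 uU wW; rewrite linearD /= (daddv_pi_id UW0 uU).
have WU0 : (W :&: U = 0)%VS by rewrite capvC.
have := daddv_pi_add UW0 (subvP (addvSr U W) _ wW).
rewrite (daddv_pi_id WU0 wW) => /(congr1 (fun z => z - w)).
by rewrite addrK subrr => ->; rewrite addr0.
Qed.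

Lemma spl_fine_full X (S : splitting X) :
  (spl0 S + spl_odd S + delta X @: spl_odd S + spl2 S = fullv)%VS.
Proof. by rewrite -[in LHS](addvA (spl0 S)) spl1_full spl_full. Qed.

Lemma spl_fine_direct X (S : splitting X) :
  directv (spl0 S + spl_odd S + delta X @: spl_odd S + spl2 S).
Proof.
have := spl_direct S; rewrite directvE /= => /eqP d.
have := spl1_direct S; rewrite directvE /= => /eqP d1.
rewrite directvE /= -[X in (X + spl2 S)%VS](addvA (spl0 S)) spl1_full d.
by rewrite -(spl1_full S) d1 addnA.
Qed.

Lemma directv4 (V : vectType F) (U1 U2 U3 U4 : {vspace V}) :
  directv (U1 + U2 + U3 + U4) -> (U1 :&: (U2 + U3 + U4) = 0)%VS.
Proof.
rewrite directvE /= -!addvA => /eqP D.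
apply/eqP; rewrite -dimv_eq0 -leqn0.
have := dimv_sum_cap U1 (U2 + (U3 + U4)); rewrite D.
have := (dimv_add_leqif U2 (U3 + U4)).1; have := (dimv_add_leqif U3 U4).1.
move=> l1 l2 e.
have l3 := leq_trans l2 (leq_add (leqnn _) l1).
rewrite -(leq_add2l (\dim U1 + \dim U2 + \dim U3 + \dim U4)) addn0 e -!addnA.
by rewrite leq_add2l.
Qed.

Lemma proj_summands X (S : splitting X) x y z w :
  x \in spl0 S -> y \in spl_odd S -> z \in (delta X @: spl_odd S)%VS ->
  w \in spl2 S ->
  vsval (proj0 S (x + y + z + w)) = x /\ vsval (proj1 S (x + y + z + w)) = y.
Proof.
move=> xS yS zS wS; have D := spl_fine_direct S; split.
  have -> : x + y + z + w = x + (y + z + w) by rewrite !addrA.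
  by rewrite proj0E daddv_pi_addE ?memv_add ?directv4.
have -> : x + y + z + w = y + (x + z + w) by rewrite !addrA [y + x]addrC.
rewrite proj1E daddv_pi_addE ?memv_add // directv4 //.
move: D; rewrite !directvE /= [(spl_odd S + _)%VS]addvC => /eqP ->.
by rewrite [(\dim (spl_odd S) + _)%N]addnC.
Qed.

Lemma sigma_delta X x : sigma X x = x + delta X x.
Proof. by rewrite /delta add_lfunE opp_lfunE id_lfunE addrC subrK. Qed.

Lemma delta_hom X Y (f : repHom X Y) x : f (delta X x) = delta Y (f x).
Proof.
by rewrite /delta !(add_lfunE, opp_lfunE) !id_lfunE linearB /= -repHomE.
Qed.

Lemma delta_copies n X (t : rep_copies n X) i :
  (delta (rep_copies n X) t : {ffun 'I_n -> X}) i
    = delta X ((t : {ffun 'I_n -> X}) i).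
Proof.
rewrite /delta !(add_lfunE, opp_lfunE) !id_lfunE !ffunE /=.
by rewrite copies_mapE ffunE.
Qed.

Lemma delta_spl0 X (S : splitting X) x : x \in spl0 S -> delta X x = 0.
Proof.
have [k [f [_ <-]]] := spl0P S => /memv_imgP[t _ ->].
rewrite -delta_hom; suff -> : delta _ t = 0 by rewrite linear0.
apply/ffunP => i; rewrite delta_copies ffunE; set v := (t : {ffun _}) i.
apply/(addrI v); rewrite -sigma_delta addr0 /sigma jordan_actE expr1.
apply/rowP => j; rewrite !ord1 !mxE big_ord1 !mxE mulr1.
by congr (v _ _); apply: val_inj.
Qed.

Lemma delta_delta_odd X (S : splitting X) x :
  x \in spl_odd S -> delta X (delta X x) = 0.
Proof.
move=> xS; have : x \in spl1 S.
  by rewrite -spl1_full (subvP (addvSl _ _)).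
have [k [f [_ <-]]] := spl1P S => /memv_imgP[t _ ->].
rewrite -!delta_hom; suff -> : delta _ (delta _ t) = 0 by rewrite linear0.
apply/ffunP => i; rewrite !delta_copies ffunE; set v := (t : {ffun _}) i.
have d1 : delta (V1 hF) (v1 hF) = 0.
  by apply/(addrI (v1 hF)); rewrite -sigma_delta addr0 sigma_v1.
have d0 : delta (V1 hF) (v0 hF) = v1 hF.
  by apply/(addrI (v0 hF)); rewrite -sigma_delta sigma_v0.
rewrite -/(V1 hF) (V1_eta v) !(linearD, linearZ) /= !(d0, d1).
by rewrite !(linear0, scaler0, addr0).
Qed.

Let iota_b X (S : splitting X) (x : sv1 (sspace S)) (v : V1 hF) : X :=
  c0 v *: vsval x + c1 v *: delta X (vsval x).

Let iota_b_bilin X (S : splitting X) : bilin (@iota_b X S).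
Proof.
split=> [x a u v|v a x y]; rewrite /iota_b.
  rewrite c0_linear c1_linear !scalerDl !scalerDr -!scalerA addrACA.
  by rewrite !scalerA.
rewrite !linearP /= addrACA; congr (_ + _ + _).
by rewrite !scalerA mulrC.
Qed.

Lemma iota_linE X (S : splitting X) x t :
  iota_lin S (x, t) = vsval x + tens_lift (@iota_b X S) t.
Proof.
apply: linfunE => a p q; rewrite !linearP /= scalerDr addrACA.
by [].
Qed.

Fact iota_subproof X (S : splitting X) :
  iota_lin S \in equivariant (Fobj hF (sspace S)) X.
Proof.
apply: equivariant_sigma => -[x t]; rewrite sum_mapE /= id_lfunE !iota_linE.
rewrite linearD /=; congr (_ + _).
  by rewrite sigma_delta (delta_spl0 (subvsP x)) addr0.
rewrite -comp_lfunE -[RHS]comp_lfunE; move: t; apply/lfunP/tens_ext => y v.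
rewrite !comp_lfunE tens_mapE !(tens_liftE (iota_b_bilin S)) id_lfunE /iota_b.
rewrite c0_sigma c1_sigma linearD !linearZ /= !sigma_delta.
rewrite (delta_delta_odd (subvsP y)) addr0 scalerDr scalerDl.
by rewrite addrA.
Qed.

Definition iota_hom X (S : splitting X) : repHom (Fobj hF (sspace S)) X :=
  RepHom (iota_subproof S).

Lemma iota_homE X (S : splitting X) :
  [/\ forall x, iota_hom S (x, 0) = vsval x,
      forall x, iota_hom S (0, x \ox v0 hF) = vsval x &
      forall x, iota_hom S (0, x \ox v1 hF) = delta X (vsval x)].
Proof.
split=> x; rewrite iota_linE ?linear0 ?addr0 ?add0r //.
  rewrite (tens_liftE (iota_b_bilin S)) /iota_b /c0 /c1 !mxE /=.
  by rewrite scale1r scale0r addr0.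
rewrite (tens_liftE (iota_b_bilin S)) /iota_b /c0 /c1 !mxE /=.
by rewrite scale1r scale0r add0r.
Qed.

Definition mlin0 X Y Z (mu : repHom (rep_tens X Y) Z) (SX : splitting X)
    (SY : splitting Y) (SZ : splitting Z) :
    'Hom(sv0 (stens (sspace SX) (sspace SY)), sv0 (sspace SZ)) :=
  linfun (fun p : sv0 (stens (sspace SX) (sspace SY)) =>
    tens_lift (fun (x : sv0 (sspace SX)) (y : sv0 (sspace SY)) =>
      proj0 SZ (mu (vsval x \ox vsval y))) p.1 +
    tens_lift (fun (x : sv1 (sspace SX)) (y : sv1 (sspace SY)) =>
      proj0 SZ (mu (vsval x \ox delta Y (vsval y)))) p.2).

Definition mlin1 X Y Z (mu : repHom (rep_tens X Y) Z) (SX : splitting X)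
    (SY : splitting Y) (SZ : splitting Z) :
    'Hom(sv1 (stens (sspace SX) (sspace SY)), sv1 (sspace SZ)) :=
  linfun (fun p : sv1 (stens (sspace SX) (sspace SY)) =>
    tens_lift (fun (x : sv0 (sspace SX)) (y : sv1 (sspace SY)) =>
      proj1 SZ (mu (vsval x \ox vsval y))) p.1 +
    tens_lift (fun (x : sv1 (sspace SX)) (y : sv0 (sspace SY)) =>
      proj1 SZ (mu (vsval x \ox vsval y))) p.2).

Definition mhom X Y Z (mu : repHom (rep_tens X Y) Z) (SX : splitting X)
    (SY : splitting Y) (SZ : splitting Z) :
    superHom (stens (sspace SX) (sspace SY)) (sspace SZ) :=
  SuperHom (mlin0 mu SX SY SZ) (mlin1 mu SX SY SZ).

Lemma mhomE X Y Z (mu : repHom (rep_tens X Y) Z) (SX : splitting X)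
    (SY : splitting Y) (SZ : splitting Z)
    (x0 : sv0 (sspace SX)) (x1 : sv1 (sspace SX))
    (y0 : sv0 (sspace SY)) (y1 : sv1 (sspace SY)) :
  let m := mhom mu SX SY SZ in
  [/\ sh0 m (x0 \ox y0, 0) = proj0 SZ (mu (vsval x0 \ox vsval y0)),
      sh1 m (x0 \ox y1, 0) = proj1 SZ (mu (vsval x0 \ox vsval y1)),
      sh1 m (0, x1 \ox y0) = proj1 SZ (mu (vsval x1 \ox vsval y0)) &
      sh0 m (0, x1 \ox y1) = proj0 SZ (mu (vsval x1 \ox delta Y (vsval y1)))].
Proof.
have bl (U V U' V' W : vectType F) (p : tens U' V' -> W)
    (f : U -> U') (g : V -> V') x y : linear p -> linear f -> linear g ->
    tens_lift (fun x y => p (f x \ox g y)) (x \ox y) = p (f x \ox g y).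
  move=> lp lf lg; apply: tens_liftE.
  by split=> [z a u v|z a u v]; rewrite ?lf ?lg ?(tpure_bilin _ _).1
    ?(tpure_bilin _ _).2 lp.
have vl (U : {vspace X}) : linear (@vsval F X U) by move=> a u v; rewrite linearP.
have wl (U : {vspace Y}) : linear (@vsval F Y U) by move=> a u v; rewrite linearP.
have dl (U : {vspace Y}) : linear (fun y => delta Y (@vsval F Y U y)).
  by move=> a u v; rewrite !linearP.
have pl0 : linear (fun t => proj0 SZ (mu t)) by move=> a u v; rewrite !linearP.
have pl1 : linear (fun t => proj1 SZ (mu t)) by move=> a u v; rewrite !linearP.
move=> m.
have sl (U V W : vectType F) (f : 'Hom(U, W)) (g : 'Hom(V, W)) :
    linear (fun p : U * V => f p.1 + g p.2).
  by move=> a p q; rewrite /= !linearP /= scalerDr addrACA.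
split; rewrite [LHS](linfunE (sl _ _ _ _ _)) /= ?linear0 ?addr0 ?add0r.
- exact: (bl _ _ _ _ _ (fun t => proj0 SZ (mu t))).
- exact: (bl _ _ _ _ _ (fun t => proj1 SZ (mu t))).
- exact: (bl _ _ _ _ _ (fun t => proj1 SZ (mu t))).
- exact: (bl _ _ _ _ _ (fun t => proj0 SZ (mu t)) vsval
    (fun y => delta Y (vsval y)) _ _ pl0 (vl _) (dl _)).
Qed.

End Splittings.

(* Main.v *)
Require Import Defs.
From mathcomp Require Import all_boot all_order all_algebra.

(* A morphism f into C is negligible as soon as its C_0-component factors
   through delta and its C_odd-component through delta^2.  Indeed split the
   trace of an equivariant h = f g along C = C_0 + C_odd + delta(C_odd) + C_2.
   The projector onto C_2 is d^2 t + d t d + t d^2 for some t (d = delta), so it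
   contributes 3 tr(t h d^2) = 0.  Since delta : C_odd -> delta(C_odd) is
   invertible, C_odd and delta(C_odd) contribute equally.  Moving delta around
   the trace, the C_0- and C_odd-contributions vanish, because delta kills C_0
   and delta^2 kills C_odd.
   Write iota = E + K + delta L, with E the even part and K, L the
   coefficients of v_0 and v_1; on F(A), L delta = K, K delta = E delta = 0.
   For the difference of the two sides of the theorem the C_0-component is then
   - mu (L (x) (E + K) + E (x) L) o delta, and the C_odd-component is
   - mu (K (x) K) = mu (L (x) L) o delta^2, as - 1 = 2. *)

Set Implicit Arguments.
Unset Strict Implicit.
Unset Printing Implicit Defensive.
Import GRing.Theory passmx.
Local Open Scope ring_scope.

(** * Linear algebra: traces, projections along direct sums, pure tensors *)

Section Linear.
Variable F : fieldType.

Lemma pchar3_sum1 : 3%N \in [pchar F] -> 1 + 1 + 1 = 0 :> F.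
Proof. by move=> hF; rewrite -(pcharf0 hF) !mulrS addr0 addrA. Qed.

Lemma traceD (V : vectType F) (f g : 'End(V)) :
  trace (f + g) = trace f + trace g.
Proof. by rewrite /trace !linearD. Qed.

(** Cycling the trace and commuting [h] with [d] turns each of the three summands into tr(th h d^2),
    so the total is a multiple of 3. *)
Lemma trace_relative_trace (V : vectType F) (d th h : 'End(V)) :
  3%N \in [pchar F] -> (h \o d = d \o h)%VF ->
  trace (((d \o (d \o th)) + (d \o (th \o d)) + (th \o (d \o d))) \o h)%VF = 0.
Proof.
move=> hF hd; rewrite !comp_lfunDl !traceD -!comp_lfunA.
pose a := trace (th \o (h \o (d \o d)))%VF.
have -> : trace (d \o (d \o (th \o h)))%VF = a.
  by rewrite trace_mulC -comp_lfunA trace_mulC -!comp_lfunA.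
have -> : trace (d \o (th \o (d \o h)))%VF = a.
  by rewrite trace_mulC -hd -!comp_lfunA.
rewrite -hd (comp_lfunA d h d) -hd -comp_lfunA -/a -[a]mulr1 -!mulrDr.
by rewrite pchar3_sum1 // mulr0.
Qed.

Lemma daddv_pi4 (V : vectType F) (U1 U2 U3 U4 : {vspace V}) x y z w :
  directv (U1 + U2 + U3 + U4) ->
  x \in U1 -> y \in U2 -> z \in U3 -> w \in U4 ->
  daddv_pi U1 (U2 + U3 + U4) (x + y + z + w) = x.
Proof.
move=> D xU yU zU wU; have -> : x + y + z + w = x + (y + z + w) by rewrite !addrA.
by rewrite daddv_pi_addE ?memv_add ?directv4.
Qed.

Lemma bilinDl (U V W : vectType F) (b : U -> V -> W) : bilin b ->
  forall x y v, b (x + y) v = b x v + b y v.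
Proof. by case=> _ lb x y v; have := lb v 1 x y; rewrite !scale1r. Qed.

Lemma bilinDr (U V W : vectType F) (b : U -> V -> W) : bilin b ->
  forall u x y, b u (x + y) = b u x + b u y.
Proof. by case=> lb _ u x y; have := lb u 1 x y; rewrite !scale1r. Qed.

Lemma tpureDl (U V : vectType F) (x y : U) (v : V) :
  (x + y) \ox v = x \ox v + y \ox v.
Proof. exact: (bilinDl (@tpure_bilin F U V)). Qed.

Lemma tpureDr (U V : vectType F) (u : U) (x y : V) :
  u \ox (x + y) = u \ox x + u \ox y.
Proof. exact: (bilinDr (@tpure_bilin F U V)). Qed.

Lemma tpure0l (U V : vectType F) (v : V) : (0 : U) \ox v = 0.
Proof. by apply: (addrI (0 \ox v)); rewrite -tpureDl !addr0. Qed.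

Lemma tpure0r (U V : vectType F) (u : U) : u \ox (0 : V) = 0.
Proof. by apply: (addrI (u \ox 0)); rewrite -tpureDr !addr0. Qed.

Lemma tpureZl (U V : vectType F) a (x : U) (v : V) :
  (a *: x) \ox v = a *: (x \ox v).
Proof.
by have := (@tpure_bilin F U V).2 v a x 0; rewrite tpure0l !addr0.
Qed.

Lemma tpureZr (U V : vectType F) a (u : U) (x : V) :
  u \ox (a *: x) = a *: (u \ox x).
Proof.
by have := (@tpure_bilin F U V).1 u a x 0; rewrite tpure0r !addr0.
Qed.

End Linear.

(** * The identity as a relative trace on V_2 and on its multiples *)

Lemma copies_relative_trace (F : fieldType) (X : rep F) k (th : 'End(X)) :
  (forall v, let d := delta X in
     v = d (d (th v)) + d (th (d v)) + th (d (d v))) ->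
  forall t, let d := delta (rep_copies k X) in let T := copies_map k th in
     t = d (d (T t)) + d (T (d t)) + T (d (d t)).
Proof.
move=> thE t d T; apply/ffunP => i.
have dE s j : (d s : {ffun 'I_k -> X}) j = delta X ((s : {ffun 'I_k -> X}) j).
  exact: delta_copies.
have TE s j : (T s : {ffun 'I_k -> X}) j = th ((s : {ffun 'I_k -> X}) j).
  by rewrite copies_mapE ffunE.
rewrite [RHS]ffunE [X in _ = X + _]ffunE.
rewrite [LHS]thE; congr (_ + _ + _).
- exact: esym (etrans (dE _ _) (congr1 _ (etrans (dE _ _) (congr1 _ (TE _ _))))).
- exact: esym (etrans (dE _ _) (congr1 _ (etrans (TE _ _) (congr1 _ (dE _ _))))).
- exact: esym (etrans (TE _ _) (congr1 _ (etrans (dE _ _) (congr1 _ (dE _ _))))).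
Qed.

Section Jordan.
Variables (F : fieldType) (hF : 3%N \in [pchar F]).

(** A shift of coordinates; [j - 1] is computed modulo 3, hence the separate case j = 0. *)
Lemma delta_V2 (v : 'rV[F]_3) :
  delta (Vrep hF (isT : (2 < 3)%N)) v =
  \row_(j < 3) (if j == 0 then 0 else v 0 (j - 1)) :> 'rV[F]_3.
Proof.
rewrite /delta add_lfunE opp_lfunE id_lfunE /sigma jordan_actE expr1.
apply/rowP => -[[|[|[|//]]] Hi]; rewrite !mxE !big_ord_recl big_ord0 !mxE /=.
all: rewrite ?(mulr0, mulr1, addr0, add0r).
- by rewrite (_ : ord0 = Ordinal Hi) ?subrr //; apply: val_inj.
- rewrite (_ : lift _ _ = Ordinal Hi) ?addrK //; last exact: val_inj.
  by congr (v _ _); apply: val_inj.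
- rewrite (_ : lift _ (lift _ _) = Ordinal Hi) ?addrK //; last exact: val_inj.
  by congr (v _ _); apply: val_inj.
Qed.

(* F[x]/x^3 with delta = x, and th sending x^2 to 1 and x, 1 to 0. *)
Lemma V2_relative_trace : exists th : 'End(Vrep hF (isT : (2 < 3)%N)),
  forall v, let d := delta (Vrep hF (isT : (2 < 3)%N)) in
  v = d (d (th v)) + d (th (d v)) + th (d (d v)).
Proof.
pose g (v : 'rV[F]_3) : 'rV[F]_3 := v 0 2%:R *: delta_mx 0 0.
have lg : linear g.
  by move=> a u v; rewrite /g !mxE scalerDl scalerA.
exists (linfun (g : Vrep hF (isT : (2 < 3)%N) -> Vrep hF (isT : (2 < 3)%N))).
move=> v d; rewrite !(linfunE lg) /d !delta_V2 /g.
by apply/rowP => -[[|[|[|//]]] Hi]; rewrite !mxE /= ?(mulr0, mulr1, addr0, add0r);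
  congr (v _ _); apply: val_inj.
Qed.
End Jordan.

(** * The four projectors of a refined splitting and their traces *)

Section Projectors.
Variables (F : fieldType) (hF : 3%N \in [pchar F]) (X : rep F).
Variable S : splitting hF X.
Local Notation d := (delta X).
Local Notation odd := (spl_odd S).

Definition spl_pi0 : 'End(X) := daddv_pi (spl0 S) (odd + d @: odd + spl2 S).
Definition spl_pi_odd : 'End(X) := daddv_pi odd (spl0 S + d @: odd + spl2 S).
Definition spl_pi_dodd : 'End(X) := daddv_pi (d @: odd) (spl0 S + odd + spl2 S).
Definition spl_pi2 : 'End(X) := daddv_pi (spl2 S) (spl0 S + odd + d @: odd).

Lemma spl_piE x y z w :
  x \in spl0 S -> y \in odd -> z \in (d @: odd)%VS -> w \in spl2 S ->
  [/\ spl_pi0 (x + y + z + w) = x, spl_pi_odd (x + y + z + w) = y,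
      spl_pi_dodd (x + y + z + w) = z & spl_pi2 (x + y + z + w) = w].
Proof.
move=> xS yS zS wS; have D := spl_fine_direct S; split.
- exact: daddv_pi4.
- rewrite [x + y]addrC daddv_pi4 //; move: D; rewrite !directvE /=.
  by rewrite [(odd + _)%VS]addvC [(\dim odd + _)%N]addnC.
- have -> : x + y + z = z + x + y by rewrite -[in RHS]addrA addrC.
  rewrite daddv_pi4 //; move: D; rewrite !directvE /=.
  have -> : (spl0 S + odd + d @: odd = d @: odd + spl0 S + odd)%VS.
    by rewrite -[in RHS]addvA addvC.
  have -> // : (\dim (spl0 S) + \dim odd + \dim (d @: odd) =
           \dim (d @: odd) + \dim (spl0 S) + \dim odd)%N.
  by rewrite -[in RHS]addnA addnC.
- have -> : x + y + z + w = w + x + y + z by rewrite addrC !addrA.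
  rewrite daddv_pi4 //; move: D; rewrite !directvE /=.
  by rewrite addvC addnC !addvA !addnA.
Qed.

Lemma spl_decomp (v : X) : exists x y z w,
  [/\ x \in spl0 S, y \in odd, z \in (d @: odd)%VS & w \in spl2 S] /\
  v = x + y + z + w.
Proof.
have : v \in (spl0 S + odd + d @: odd + spl2 S)%VS by rewrite spl_fine_full memvf.
case/memv_addP => u /memv_addP[u' /memv_addP[x xS [y yS ->]] [z zS ->]] [w wS ->].
by exists x, y, z, w.
Qed.

Lemma delta_spl2 w : w \in spl2 S -> d w \in spl2 S.
Proof.
have [k [f [_ <-]]] := spl2P S => /memv_imgP[t _ ->].
by rewrite -delta_hom memv_img // memvf.
Qed.

Lemma delta_imodd z : z \in (d @: odd)%VS -> d z = 0.
Proof. by case/memv_imgP => y yS ->; rewrite (delta_delta_odd yS). Qed.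

(** On copies of V_1 the kernel of delta equals its image, and delta([spl1]) = delta([odd]) because
    delta^2 kills [odd]. So y lies in both [odd] and delta([odd]), which meet in 0. *)
Lemma delta_odd_eq0 y : y \in odd -> d y = 0 -> y = 0.
Proof.
move=> yS dy0; suff : y \in (d @: odd)%VS.
  move=> yS'; have : y \in (odd :&: d @: odd)%VS by rewrite memv_cap yS.
  have /directv_addP -> := spl1_direct S.
  by rewrite memv0 => /eqP.
have : y \in spl1 S by rewrite -spl1_full (subvP (addvSl _ _)).
have [k [f [f0 fim]]] := spl1P S; rewrite -fim => /memv_imgP[t _ def_y].
have kf : injective f by apply/lker0P; rewrite f0.
have dt0 : delta _ t = 0 by apply: kf; rewrite delta_hom -def_y dy0 linear0.
have d1 : delta (V1 hF) (v1 hF) = 0.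
  by apply/(addrI (v1 hF)); rewrite -sigma_delta addr0 sigma_v1.
have d0 : delta (V1 hF) (v0 hF) = v1 hF.
  by apply/(addrI (v0 hF)); rewrite -sigma_delta sigma_v0.
have dE v : delta (V1 hF) v = c0 v *: v1 hF.
  by rewrite {1}[v]V1_eta linearD !linearZ /= d0 d1 scaler0 addr0.
(* Since delta kills [t], every component of [t] is a multiple of v_1 = delta(v_0); replacing v_1 by
   v_0 gives a preimage of [t] under delta. *)
pose s : {ffun 'I_k -> V1 hF} :=
  [ffun i => c1 ((t : {ffun 'I_k -> V1 hF}) i) *: v0 hF].
have def_t : t = delta (rep_copies k (V1 hF)) s.
  apply/ffunP => i; rewrite [RHS](delta_copies (X := V1 hF) s) ffunE dE.
  set v := (t : {ffun _}) i.
  have : delta (V1 hF) v = 0.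
    by rewrite -[LHS](delta_copies (X := V1 hF) t) dt0 ffunE.
  have e1 : c0 (c1 v *: v0 hF) = c1 v by rewrite /c0 !mxE /= mulr1.
  rewrite dE e1 => /(congr1 (fun u => c1 u)).
  rewrite {1 3}/c1 !mxE /= mulr1 => z.
by rewrite [LHS](V1_eta v) z {1}/c1 mxE scale0r add0r.
have : f s \in spl1 S by rewrite -fim memv_img // memvf.
rewrite def_y def_t delta_hom -spl1_full => /memv_addP[a aS [b bS ->]].
by rewrite linearD /= (delta_imodd bS) addr0 memv_img.
Qed.

Lemma spl_pi_delta v : [/\ spl_pi0 (d v) = 0, spl_pi_odd (d v) = 0,
  spl_pi_dodd (d v) = d (spl_pi_odd v) &
  spl_pi2 (d v) = d (spl_pi2 v)].
Proof.
have [x [y [z [w [[xS yS zS wS] ->]]]]] := spl_decomp v.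
have [_ -> _ ->] := spl_piE xS yS zS wS.
have -> : d (x + y + z + w) = 0 + 0 + d y + d w.
  by rewrite !linearD /= (delta_spl0 xS) (delta_imodd zS) !(addr0, add0r).
by have [-> -> -> ->] := spl_piE (mem0v (spl0 S)) (mem0v odd) (memv_img d yS)
                           (delta_spl2 wS).
Qed.

Lemma spl_pi_mem v : [/\ spl_pi0 v \in spl0 S, spl_pi_odd v \in odd,
  spl_pi_dodd v \in (d @: odd)%VS &
  spl_pi2 v \in spl2 S].
Proof.
have [x [y [z [w [[xS yS zS wS] ->]]]]] := spl_decomp v.
by have [-> -> -> ->] := spl_piE xS yS zS wS.
Qed.

Lemma spl_pi_sum v : v = spl_pi0 v + spl_pi_odd v + spl_pi_dodd v + spl_pi2 v.
Proof.
have [x [y [z [w [[xS yS zS wS] ->]]]]] := spl_decomp v.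
by have [-> -> -> ->] := spl_piE xS yS zS wS.
Qed.

Lemma spl_pi0_id x : x \in spl0 S -> spl_pi0 x = x.
Proof.
move=> xS; have [] := spl_piE xS (mem0v odd) (mem0v (d @: odd)) (mem0v (spl2 S)).
by rewrite !addr0.
Qed.

Lemma spl_pi_odd_id y : y \in odd -> spl_pi_odd y = y.
Proof.
move=> yS; have [] := spl_piE (mem0v (spl0 S)) yS (mem0v (d @: odd)) (mem0v (spl2 S)).
by rewrite !addr0 add0r.
Qed.

(** The delta([odd])-component of [d v] is delta of the [odd]-component of [v], and delta is
    injective on [odd]. *)
Lemma spl_pi_odd_invariant v : d v = 0 -> spl_pi_odd v = 0.
Proof.
move=> dv0; apply: delta_odd_eq0; first by have [] := spl_pi_mem v.
by have [_ _ <- _] := spl_pi_delta v; rewrite dv0 linear0.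
Qed.

(** With tau inverse to delta : odd -> delta(odd) and zero on the other summands, d tau and tau d
    are the two projectors, so tr(d tau h) = tr(tau h d) = tr(tau d h). *)
Lemma trace_spl_pi_dodd (h : 'End(X)) : (h \o d = d \o h)%VF ->
  trace (spl_pi_dodd \o h)%VF = trace (spl_pi_odd \o h)%VF.
Proof.
move=> hd; pose f := (d \o spl_pi_odd)%VF.
(* [f^-1] gives some preimage under [f], possibly outside [odd]; the outer [spl_pi_odd] moves it
   into [odd] without changing its image under [f]. *)
pose tau := (spl_pi_odd \o f^-1 \o spl_pi_dodd)%VF.
have dtau : (d \o tau = spl_pi_dodd)%VF.
  rewrite /tau !comp_lfunA; apply/lfunP => v; rewrite !comp_lfunE /=.
  rewrite -[d (spl_pi_odd _)]comp_lfunE -/f limg_lfunVK //.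
  have [_ _ /memv_imgP[y yS ->] _] := spl_pi_mem v.
  by rewrite -[y](spl_pi_odd_id yS) -comp_lfunE memv_img ?memvf.
(* Both sides take values in [odd], so they may be compared after applying delta. *)
have taud : (tau \o d = spl_pi_odd)%VF.
  apply/lfunP => v; apply/eqP; rewrite -subr_eq0; apply/eqP; apply: delta_odd_eq0.
    rewrite comp_lfunE [tau _]comp_lfunE comp_lfunE rpredB //.
      by have [] := spl_pi_mem (f^-1%VF (spl_pi_dodd (d v))).
    by have [] := spl_pi_mem v.
  rewrite linearB /= [(tau \o d)%VF v]comp_lfunE -[d (tau _)]comp_lfunE dtau.
  by have [_ _ -> _] := spl_pi_delta v; rewrite subrr.
by rewrite -dtau -comp_lfunA trace_mulC -comp_lfunA hd comp_lfunA taud.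
Qed.

(** The identity on copies of V_2 is transported along the embedding [f] onto [spl2]. In
    characteristic 3 the right-hand side is the sum of the C_3-conjugates of th sigma^-1, so this is
    Higman's criterion for the projective summand. *)
Lemma spl_pi2_relative_trace : exists th : 'End(X),
  spl_pi2 = ((d \o (d \o th)) + (d \o (th \o d)) + (th \o (d \o d)))%VF.
Proof.
have [k [f [f0 fim]]] := spl2P S; have [th thE] := V2_relative_trace hF.
set V2 := Vrep hF _ in f f0 fim th thE *.
have /lker0P kf : lker f == 0%VS by rewrite f0.
(* [r] projects X to the copies of V_2; it commutes with delta because [f] is injective and both [f]
   and [spl_pi2] do. *)
pose r := (f^-1 \o spl_pi2)%VF.
have fr v : f (r v) = spl_pi2 v.
  rewrite comp_lfunE limg_lfunVK // fim; by have [] := spl_pi_mem v.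
have rd v : r (d v) = delta _ (r v).
  by apply: kf; rewrite fr delta_hom fr; have [] := spl_pi_delta v.
have [T TE] : exists T : 'End(X), forall v, T v = f (copies_map k th (r v)).
  by exists (f \o (copies_map k th \o r))%VF => v; rewrite !comp_lfunE.
exists T; apply/lfunP => v; rewrite !add_lfunE !comp_lfunE !TE.
rewrite -fr !rd -!delta_hom [X in f X = _](copies_relative_trace thE (r v)).
by rewrite [LHS]linearD [X in X + _ = _]linearD.
Qed.

Lemma trace_spl_pi2 (h : 'End(X)) : (h \o d = d \o h)%VF ->
  trace (spl_pi2 \o h)%VF = 0.
Proof.
move=> hd; have [th ->] := spl_pi2_relative_trace.
exact: trace_relative_trace.
Qed.

End Projectors.

(** * The criterion for negligibility *)

Section Criterion.
Variables (F : fieldType) (hF : 3%N \in [pchar F]) (X Y : rep F).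
Variable S : splitting hF X.

(** [phi] and [psi] are merely linear: delta is moved past the equivariant [g] and then around the
    trace, never past [phi] or [psi]. *)
Lemma negligible_splitting (f : repHom Y X) (phi psi : 'Hom(Y, X)) :
  (spl_pi0 S \o f = spl_pi0 S \o (phi \o delta Y))%VF ->
  (spl_pi_odd S \o f = spl_pi_odd S \o (psi \o (delta Y \o delta Y)))%VF ->
  f \in negligible Y X.
Proof.
move=> /lfunP ephi /lfunP epsi; apply/negligibleP => g.
have fphi y : spl_pi0 S (f y) = spl_pi0 S (phi (delta Y y)).
  by have := ephi y; rewrite !comp_lfunE.
have fpsi y : spl_pi_odd S (f y) = spl_pi_odd S (psi (delta Y (delta Y y))).
  by have := epsi y; rewrite !comp_lfunE.
set h := (f \o g)%VF; set d := delta X.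
have hd : (h \o d = d \o h)%VF.
  by apply/lfunP => v; rewrite !comp_lfunE !delta_hom.
have tr0 : trace (spl_pi0 S \o h)%VF = 0.
  (* The projector is doubled so that, after cycling one copy, [d] is directly followed on its right
     by [spl_pi0] and the composite vanishes. *)
  have -> : (spl_pi0 S \o h = spl_pi0 S \o (spl_pi0 S \o phi \o g \o d))%VF.
    apply/lfunP => v; rewrite !comp_lfunE -/d delta_hom fphi [RHS]spl_pi0_id //.
    by have [] := spl_pi_mem S (phi (delta Y (g v))).
  rewrite trace_mulC -comp_lfunA.
  have -> : (d \o spl_pi0 S = 0)%VF; last by rewrite comp_lfun0r trace0.
  apply/lfunP => v; rewrite comp_lfunE zero_lfunE.
  by have [xS _ _ _] := spl_pi_mem S v; rewrite (delta_spl0 xS).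
have tr1 : trace (spl_pi_odd S \o h)%VF = 0.
  have -> : (spl_pi_odd S \o h =
      spl_pi_odd S \o (spl_pi_odd S \o psi \o g \o (d \o d)))%VF.
    apply/lfunP => v; rewrite !comp_lfunE -/d !delta_hom fpsi.
    have [_ yS _ _] := spl_pi_mem S (psi (delta Y (delta Y (g v)))).
    by rewrite (spl_pi_odd_id yS).
  rewrite trace_mulC -comp_lfunA.
  have -> : ((d \o d) \o spl_pi_odd S = 0)%VF; last by rewrite comp_lfun0r trace0.
  apply/lfunP => v; rewrite !comp_lfunE zero_lfunE.
  by have [_ yS _ _] := spl_pi_mem S v; rewrite (delta_delta_odd yS).
have -> : h = ((spl_pi0 S \o h) + (spl_pi_odd S \o h) +
    (spl_pi_dodd S \o h) + (spl_pi2 S \o h))%VF.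
  by apply/lfunP => v; rewrite !add_lfunE !comp_lfunE -spl_pi_sum.
by rewrite !traceD trace_spl_pi_dodd // trace_spl_pi2 // tr0 tr1 !addr0.
Qed.
End Criterion.

(** * Maps out of F(X) and F(X) (x) F(Y); delta on tensor products *)

Section Fobj.
Variables (F : fieldType) (hF : 3%N \in [pchar F]).
Implicit Types (X Y : superspace F) (W : vectType F).

Lemma Fobj_ext Y W (f g : 'Hom(Fobj hF Y, W)) :
  (forall x, f (x, 0) = g (x, 0)) ->
  (forall y v, f (0, y \ox v) = g (0, y \ox v)) -> f = g.
Proof.
move=> f0 f1; apply/lfunP => -[x t].
have -> : (x, t) = (x, 0) + (0, t) :> Fobj hF Y.
  by congr pair; rewrite /= ?addr0 ?add0r.
rewrite !linearD /= f0; congr (_ + _).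
elim/tens_ind: t => [||//]; first by rewrite !linear0.
move=> s t fs ft.
have -> : (0, s + t) = (0, s) + (0, t) :> Fobj hF Y.
  by congr pair; rewrite /= ?addr0.
by rewrite !linearD /= fs ft.
Qed.

Lemma tens_Fobj_ext X Y W (f g : 'Hom(tens (Fobj hF X) (Fobj hF Y), W)) :
  (forall x y, f ((x, 0) \ox (y, 0)) = g ((x, 0) \ox (y, 0))) ->
  (forall x y v, f ((x, 0) \ox (0, y \ox v)) = g ((x, 0) \ox (0, y \ox v))) ->
  (forall x u y, f ((0, x \ox u) \ox (y, 0)) = g ((0, x \ox u) \ox (y, 0))) ->
  (forall x u y v, f ((0, x \ox u) \ox (0, y \ox v)) =
                   g ((0, x \ox u) \ox (0, y \ox v))) ->
  f = g.
Proof.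
move=> f00 f01 f10 f11; apply: tens_ext => p q.
have ll (h : 'Hom(tens (Fobj hF X) (Fobj hF Y), W)) b :
    linear (fun a => h (a \ox b)).
  by move=> c a a'; rewrite tpureDl tpureZl linearP.
have lr (h : 'Hom(tens (Fobj hF X) (Fobj hF Y), W)) a :
    linear (fun b => h (a \ox b)).
  by move=> c b b'; rewrite tpureDr tpureZr linearP.
rewrite -[LHS](linfunE (ll f q)) -[RHS](linfunE (ll g q)).
congr (fun_of_lfun _ p); apply: Fobj_ext => [x|x u].
  rewrite (linfunE (ll f q)) (linfunE (ll g q)).
  rewrite -[LHS](linfunE (lr f _)) -[RHS](linfunE (lr g _)).
  congr (fun_of_lfun _ q); apply: Fobj_ext => [y|y v];
    by rewrite (linfunE (lr f _)) (linfunE (lr g _)).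
rewrite (linfunE (ll f q)) (linfunE (ll g q)).
rewrite -[LHS](linfunE (lr f _)) -[RHS](linfunE (lr g _)).
congr (fun_of_lfun _ q); apply: Fobj_ext => [y|y v];
  by rewrite (linfunE (lr f _)) (linfunE (lr g _)).
Qed.

(** Expand (1 + delta) (x) (1 + delta); the third term measures how far delta is from being a
    derivation. *)
Lemma delta_tens (X Y : rep F) (x : X) (y : Y) :
  delta (rep_tens X Y) (x \ox y) =
  delta X x \ox y + x \ox delta Y y + delta X x \ox delta Y y.
Proof.
apply: (addrI (x \ox y)).
rewrite -[LHS](sigma_delta (X := rep_tens X Y)) /sigma /= tens_mapE.
rewrite -/(sigma X) -/(sigma Y) !sigma_delta tpureDl !tpureDr.
by rewrite -!addrA; congr (_ + _); rewrite addrCA.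
Qed.

End Fobj.

(** * The maps E, K, L on F(X) and their relation to iota *)

Section Components.
Variables (F : fieldType) (hF : 3%N \in [pchar F]) (X : rep F).
Variable S : splitting hF X.
Local Notation FX := (Fobj hF (sspace S)).

Definition even_part : 'Hom(FX, X) := linfun (fun p : FX => vsval p.1).

(** Contraction of the V_1 factor by a functional; [c0] and [c1] give K and L. *)
Definition odd_part (c : V1 hF -> F^o) : 'Hom(FX, X) :=
  linfun (fun p : FX =>
    tens_lift (fun (x : sv1 (sspace S)) v => (c v : F) *: vsval x) p.2).

Lemma even_partE p : even_part p = vsval p.1.
Proof. by apply: linfunE => a u v; rewrite !linearP. Qed.

Lemma odd_partE c t x :
  odd_part c (x, t) =
  tens_lift (fun (x : sv1 (sspace S)) v => (c v : F) *: vsval x) t.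
Proof. by apply: linfunE => a u v; rewrite !linearP. Qed.

Lemma odd_part_tpure c x y v : linear c ->
  odd_part c (x, y \ox v) = (c v : F) *: vsval y.
Proof.
move=> lc; rewrite odd_partE tens_liftE //.
split=> [z a s t|z a s t]; first by rewrite lc scalerDl scalerA.
by rewrite [vsval _]linearP scalerDr !scalerA mulrC.
Qed.

Lemma odd_part0 c x : odd_part c (x, 0) = 0.
Proof. by rewrite odd_partE linear0. Qed.

Definition v0_part := odd_part (@c0 F hF).
Definition v1_part := odd_part (@c1 F hF).

Lemma delta_subE (Y : rep F) y : delta Y y = sigma Y y - y.
Proof. by rewrite /delta add_lfunE opp_lfunE id_lfunE. Qed.

Lemma delta_Fobj0 (Y : superspace F) y : delta (Fobj hF Y) (y, 0) = 0.
Proof.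
by rewrite delta_subE /sigma sum_mapE /= linear0 id_lfunE subrr.
Qed.

Lemma delta_Fobj1 (Y : superspace F) y v :
  delta (Fobj hF Y) (0, y \ox v) = (0, y \ox delta (V1 hF) v).
Proof.
rewrite delta_subE /sigma sum_mapE /= linear0 tens_mapE id_lfunE; congr pair.
  by rewrite /= subr0.
have -> : delta (V1 hF) v = rep_act (V1 hF) 1 v - v by rewrite delta_subE.
by rewrite tpureDr -[- v]scaleN1r tpureZr scaleN1r.
Qed.

Lemma c0_delta v : c0 (delta (V1 hF) v) = 0.
Proof.
rewrite delta_subE /c0 !mxE -[X in X - _]/(c0 (sigma (V1 hF) v)) c0_sigma.
by rewrite subrr.
Qed.

Lemma c1_delta v : c1 (delta (V1 hF) v) = c0 v.
Proof.
rewrite delta_subE /c1 !mxE -[X in X - _]/(c1 (sigma (V1 hF) v)) c1_sigma.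
by rewrite addrK.
Qed.

(** On F(X) delta acts through the V_1 factor only, where c0 delta = 0 and c1 delta = c0. *)
Lemma parts_delta p : [/\ even_part (delta FX p) = 0, v0_part (delta FX p) = 0 &
  v1_part (delta FX p) = v0_part p].
Proof.
have e : (even_part \o delta FX = 0)%VF.
  apply: Fobj_ext => [x|y v]; rewrite zero_lfunE comp_lfunE.
    by rewrite delta_Fobj0 linear0.
  by rewrite delta_Fobj1 even_partE linear0.
have k : (v0_part \o delta FX = 0)%VF.
  apply: Fobj_ext => [x|y v]; rewrite zero_lfunE comp_lfunE.
    by rewrite delta_Fobj0 linear0.
  by rewrite delta_Fobj1 odd_part_tpure ?c0_delta ?scale0r //; apply: c0_linear.
have l : (v1_part \o delta FX = v0_part)%VF.
  apply: Fobj_ext => [x|y v]; rewrite comp_lfunE.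
    by rewrite delta_Fobj0 linear0 [RHS]odd_part0.
  rewrite delta_Fobj1 !odd_part_tpure ?c1_delta //; [exact: c0_linear|exact: c1_linear].
by rewrite -!(comp_lfunE _ (delta FX)) e k l !zero_lfunE.
Qed.

Lemma iota_homE_parts p :
  iota_hom S p = even_part p + v0_part p + delta X (v1_part p).
Proof.
have [i0 iv0 iv1] := iota_homE S.
have -> : iota_hom S p = (even_part + v0_part + (delta X \o v1_part))%VF p.
  move: p; apply/lfunP/Fobj_ext => [x|y v]; rewrite !add_lfunE comp_lfunE.
    by rewrite i0 even_partE [v0_part _]odd_part0 [v1_part _]odd_part0 linear0 !addr0.
  rewrite even_partE [v0_part _]odd_part_tpure; last exact: c0_linear.
  rewrite [v1_part _]odd_part_tpure; last exact: c1_linear.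
  have -> : (0, y \ox v) = c0 v *: (0, y \ox v0 hF) + c1 v *: (0, y \ox v1 hF) :> FX.
    rewrite {1}[v]V1_eta tpureDr !tpureZr; congr pair.
    by rewrite /= !scaler0 addr0.
  by rewrite linearD !linearZ /= iv0 iv1 linear0 scaler0 !add0r.
by rewrite [LHS]add_lfunE [X in X + _]add_lfunE [X in _ + X]comp_lfunE.
Qed.

Lemma parts_mem p : [/\ even_part p \in spl0 S, v0_part p \in spl_odd S &
  v1_part p \in spl_odd S].
Proof.
have V c : odd_part c p \in spl_odd S.
  case: p => x t; rewrite odd_partE tens_lift_raw.
  apply: rpred_sum => i _; apply: rpred_sum => j _.
  by rewrite !rpredZ // subvsP.
by rewrite even_partE subvsP; split=> //; apply: V.
Qed.

Lemma parts_even x :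
  [/\ even_part (x, 0) = vsval x, v0_part (x, 0) = 0 & v1_part (x, 0) = 0].
Proof. by rewrite even_partE /v0_part /v1_part !odd_part0. Qed.

Lemma parts_odd y v : [/\ even_part (0, y \ox v) = 0,
  v0_part (0, y \ox v) = c0 v *: vsval y & v1_part (0, y \ox v) = c1 v *: vsval y].
Proof.
have lc0 := @c0_linear F hF; have lc1 := @c1_linear F hF.
by rewrite even_partE /v0_part /v1_part !odd_part_tpure // linear0.
Qed.

Lemma spl_pi_iota p : spl_pi0 S (iota_hom S p) = even_part p /\
  spl_pi_odd S (iota_hom S p) = v0_part p.
Proof.
have [eS kS lS] := parts_mem p.
have [] := spl_piE eS kS (memv_img (delta X) lS) (mem0v (spl2 S)).
by rewrite iota_homE_parts addr0 => -> ->.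
Qed.

End Components.

(** The shape of the C_0-component of the defect: [a] is the even-even term and [x - y] the odd-odd
    product, common to both sides. *)
Lemma addr_cancel (V : zmodType) (a b c x y : V) :
  a + x - y - (a + b + c + (x - y)) = - (b + c).
Proof.
rewrite -[a + x - y]addrA -(addrA a b c); set s := x - y; set t := b + c.
by rewrite [a + t + s]addrAC [- (a + s + t)]opprD addrA subrr add0r.
Qed.

Lemma linear_fun0 (F : fieldType) (U V : vectType F) (f : U -> V) :
  linear f -> f 0 = 0.
Proof. by move=> lf; rewrite -(linfunE lf) linear0. Qed.

(** * Linear maps on a tensor product that factor through coinvariants *)

Section Coinvariants.
Variables (F : fieldType) (A B : rep F) (W : vectType F).
Variable M : 'Hom(rep_tens A B, W).
Hypothesis Md : forall t, M (delta (rep_tens A B) t) = 0.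

(** The tensor is itself delta(a (x) delta b). *)
Lemma coinv_delta2 a b : delta B (delta B b) = 0 ->
  M (delta A a \ox delta B b) = 0.
Proof.
by move=> b2; rewrite -[RHS](Md (a \ox delta B b)) delta_tens b2 !tpure0r !addr0.
Qed.

(** Integration by parts: apply [Md] to a (x) b and drop the quadratic term. *)
Lemma coinv_delta_swap a b : delta B (delta B b) = 0 ->
  M (delta A a \ox b) = - M (a \ox delta B b).
Proof.
move=> b2; apply/eqP; rewrite -addr_eq0 -linearD; apply/eqP.
by rewrite -[RHS](Md (a \ox b)) delta_tens [RHS]linearD
  [X in _ = _ + X]coinv_delta2 // addr0.
Qed.

(** Three of the nine products vanish and one is integrated by parts; the last bracket then carries
    the signs of [lam], as the super side does. *)
Lemma coinv_expand e k l e' k' l' :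
  delta A e = 0 -> delta A (delta A k) = 0 -> delta A (delta A l) = 0 ->
  delta B e' = 0 -> delta B (delta B k') = 0 -> delta B (delta B l') = 0 ->
  M ((e + k + delta A l) \ox (e' + k' + delta B l')) =
  M (e \ox e') + M (e \ox k') + (M (k \ox e') + M (k \ox k'))
   + (M (k \ox delta B l') - M (l \ox delta B k')).
Proof.
move=> de dk dl de' dk' dl'.
have z1 : M (e \ox delta B l') = 0.
  by rewrite -(Md (e \ox l')) delta_tens de !tpure0l add0r addr0.
have z2 : M (delta A l \ox e') = 0.
  by rewrite -(Md (l \ox e')) delta_tens de' !tpure0r !addr0.
rewrite !tpureDl !tpureDr !linearD /= z1 z2 (coinv_delta2 _ dl').
by rewrite (coinv_delta_swap _ dk') !addr0 add0r !addrA.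
Qed.

(* If M also kills invariants, both the sum (by coinv_delta_swap) and the
   difference of M (a (x) d b) and M (d a (x) b) vanish. *)
Lemma coinv_inv_odd a b : 3%N \in [pchar F] ->
  (forall t, delta (rep_tens A B) t = 0 -> M t = 0) ->
  delta A (delta A a) = 0 -> delta B (delta B b) = 0 ->
  M (a \ox delta B b) = 0.
Proof.
move=> hF Mk a2 b2; set x := M _.
have e : x + x = 0.
  (* The difference is invariant, since delta sends both a (x) delta b and delta a (x) b to delta a
     (x) delta b. *)
  rewrite -[X in _ + X]opprK -(coinv_delta_swap _ b2) -linearB; apply: Mk.
  rewrite linearB /= !delta_tens a2 b2 !tpure0r !tpure0l !addr0 !add0r.
  by rewrite subrr.
have -> : x = (1 + 1 + 1) *: x - (x + x).
  by rewrite !scalerDl !scale1r -[x + x + x]addrA addrK.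
by rewrite e subr0 pchar3_sum1 // scale0r.
Qed.
End Coinvariants.

Lemma repHom_subE (F : fieldType) (X Y : rep F) (f g : repHom X Y) x :
  (f - g) x = f x - g x.
Proof. by rewrite add_lfunE opp_lfunE. Qed.

(** * Expressing E and K terms through L followed by delta *)

Section Lowering.
Variables (F : fieldType) (P Q A B : rep F).
Variables (E K L : 'Hom(P, A)) (E' K' L' : 'Hom(Q, B)).
Hypotheses (Ed : forall p, E (delta P p) = 0) (Kd : forall p, K (delta P p) = 0)
  (Ld : forall p, L (delta P p) = K p).
Hypotheses (Ed' : forall q, E' (delta Q q) = 0)
  (Kd' : forall q, K' (delta Q q) = 0) (Ld' : forall q, L' (delta Q q) = K' q).

(** Of the three terms of delta on a tensor, L (x) (E' + K') only sees delta (x) 1 and E (x) L' only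
    sees 1 (x) delta. *)
Lemma tens_map_lower p q :
  tens_map L (E' + K') (delta (rep_tens P Q) (p \ox q)) +
  tens_map E L' (delta (rep_tens P Q) (p \ox q)) =
  K p \ox (E' q + K' q) + E p \ox K' q.
Proof.
rewrite !delta_tens.
have D (f : 'Hom(tens P Q, tens A B)) x y z : f (x + y + z) = f x + f y + f z.
  by rewrite !linearD.
have S y : (E' + K') y = E' y + K' y by rewrite add_lfunE.
rewrite !D !tens_mapE !S Ed Ed' Kd' Ld Ld'.
by rewrite !(addr0, tpure0l, tpure0r, add0r).
Qed.

(** Up to terms with delta^2 in one factor, which L or L' kills, the square of delta on a tensor
    product is 2 delta (x) delta. *)
Lemma tens_map_lower2 p q :
  tens_map L L' (delta (rep_tens P Q) (delta (rep_tens P Q) (p \ox q))) =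
  K p \ox K' q + K p \ox K' q.
Proof.
have D (f : 'Hom(tens P Q, tens A B)) x y z : f (x + y + z) = f x + f y + f z.
  by rewrite !linearD.
have e x y : tens_map L L' (delta (rep_tens P Q) (x \ox y)) =
    K x \ox L' y + L x \ox K' y + K x \ox K' y.
  by rewrite delta_tens D !tens_mapE !Ld !Ld'.
rewrite -[LHS]comp_lfunE delta_tens D !comp_lfunE !e !Kd !Kd' !Ld !Ld'.
by rewrite !(addr0, tpure0l, tpure0r, add0r).
Qed.

End Lowering.

(** * Components of the two sides and negligibility of their difference *)

Section Main.
Variables (F : fieldType) (hF : 3%N \in [pchar F]) (A B C : rep F).
Variable mu : repHom (rep_tens A B) C.
Variables (SA : splitting hF A) (SB : splitting hF B) (SC : splitting hF C).
Local Notation FA := (Fobj hF (sspace SA)).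
Local Notation FB := (Fobj hF (sspace SB)).
Local Notation m := (mhom mu SA SB SC).

Definition super_side : repHom (rep_tens FA FB) C :=
  repComp (iota_hom SC)
    (repComp (Frep hF m) (Jrep hF (sspace SA) (sspace SB))).

Lemma FrepE p : Frep hF m p = (sh0 m p.1, tens_map (sh1 m) \1%VF p.2).
Proof. by rewrite sum_mapE. Qed.

Lemma spl_pi0_super_sideE t : spl_pi0 SC (super_side t) =
  vsval (sh0 m (Jrep hF (sspace SA) (sspace SB) t).1).
Proof. by rewrite !comp_lfunE (spl_pi_iota _).1 FrepE even_partE. Qed.

Lemma spl_pi_odd_super_sideE t : spl_pi_odd SC (super_side t) = v0_part SC (0,
  tens_map (sh1 m) \1%VF (Jrep hF (sspace SA) (sspace SB) t).2).
Proof. by rewrite !comp_lfunE (spl_pi_iota _).2 FrepE /v0_part !odd_partE. Qed.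

Lemma Jrep_even_even x y :
  Jrep hF (sspace SA) (sspace SB) ((x, 0) \ox (y, 0)) = ((x \ox y, 0), 0).
Proof.
rewrite [LHS]JlinE /=; congr pair.
  by congr pair; rewrite /= /Jlam linear0.
by rewrite (linear_fun0 (@Jl_linr _ _ _ _ _)) (linear_fun0 (@Jr_linl _ _ _ _ _)) addr0.
Qed.

Lemma Jrep_even_odd x y v :
  Jrep hF (sspace SA) (sspace SB) ((x, 0) \ox (0, y \ox v)) =
  (0, (x \ox y, 0) \ox v).
Proof.
rewrite [LHS]JlinE /= JlE; congr pair.
  by congr pair; rewrite /= ?tpure0r // /Jlam linear0.
by rewrite (linear_fun0 (@Jr_linl _ _ _ _ _)) addr0.
Qed.

Lemma Jrep_odd_even x u y :
  Jrep hF (sspace SA) (sspace SB) ((0, x \ox u) \ox (y, 0)) =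
  (0, (0, x \ox y) \ox u).
Proof.
rewrite [LHS]JlinE /= JrE; congr pair.
  by congr pair; rewrite /= ?tpure0l // (linear_fun0 (@Jlam_linr _ _ _ _ _)).
by rewrite (linear_fun0 (@Jl_linr _ _ _ _ _)) add0r.
Qed.

Lemma Jrep_odd_odd x u y v :
  Jrep hF (sspace SA) (sspace SB) ((0, x \ox u) \ox (0, y \ox v)) =
  ((0, (c0 u * c1 v - c1 u * c0 v) *: (x \ox y)), 0).
Proof.
rewrite [LHS]JlinE /= JlamE lamE tpure0l; congr pair.
by rewrite (linear_fun0 (@Jl_linl _ _ _ _ _)) (linear_fun0 (@Jr_linr _ _ _ _ _)) addr0.
Qed.

Local Notation EA := (even_part SA). Local Notation KA := (v0_part SA).
Local Notation LA := (v1_part SA).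
Local Notation EB := (even_part SB). Local Notation KB := (v0_part SB).
Local Notation LB := (v1_part SB).

(** Both sides are linear in the tensor, so it suffices to compare them on the four combinations of
    parities. *)
Lemma spl_pi0_super_side p q : spl_pi0 SC (super_side (p \ox q)) =
  spl_pi0 SC (mu (EA p \ox EB q)) + spl_pi0 SC (mu (KA p \ox delta B (LB q)))
   - spl_pi0 SC (mu (LA p \ox delta B (KB q))).
Proof.
have [M ME] : exists M : 'Hom(rep_tens A B, C),
      forall t, spl_pi0 SC (mu t) = M t.
  by exists (spl_pi0 SC \o mu)%VF => t; rewrite comp_lfunE.
rewrite !ME.
have e : (spl_pi0 SC \o super_side = M \o (tens_map EA EB + tens_map KA (delta B \o LB)
   - tens_map LA (delta B \o KB)))%VF.
  apply: tens_Fobj_ext => [x y|x y v|x u y|x u y v]; rewrite [RHS]comp_lfunE;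
    rewrite [X in M X]add_lfunE [X in M (X + _)]add_lfunE [X in M (_ + X)]opp_lfunE;
    rewrite !tens_mapE [LHS]comp_lfunE spl_pi0_super_sideE !comp_lfunE.
  - rewrite Jrep_even_even /=; have [-> _ _ _] := mhomE mu SC x 0 y 0.
    have [-> -> ->] := parts_even x; have [-> -> ->] := parts_even y.
    by rewrite !tpure0l subr0 addr0 -ME proj0E.
  - rewrite Jrep_even_odd /= linear0.
    have [-> -> ->] := parts_even x; have [-> -> ->] := parts_odd y v.
    by rewrite !tpure0l tpure0r subr0 addr0 !linear0.
  - rewrite Jrep_odd_even /= linear0.
    have [-> -> ->] := parts_odd x u; have [-> -> ->] := parts_even y.
    by rewrite !linear0 !tpure0l !tpure0r subr0 addr0 !linear0.
  (* Odd times odd: the two products of coordinates in [lam] produce the K (x) delta L and L (x)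
     delta K terms. *)
  rewrite Jrep_odd_odd /=; have [-> -> ->] := parts_odd x u.
  have [-> -> ->] := parts_odd y v.
  have -> : (0, (c0 u * c1 v - c1 u * c0 v) *: (x \ox y)) =
     (c0 u * c1 v - c1 u * c0 v) *: (0, x \ox y)
     :> sv0 (stens (sspace SA) (sspace SB)).
    by congr pair; rewrite /= scaler0.
  rewrite linearZ /=; have [_ _ _ ->] := mhomE mu SC 0 x 0 y.
  rewrite tpure0l add0r !linearZ /= !tpureZl !tpureZr !scalerA -scalerBl.
  by rewrite linearZ /= -ME proj0E.
rewrite -[LHS]comp_lfunE e [LHS]comp_lfunE -linearD -linearB.
congr (M _).
rewrite [LHS]add_lfunE [X in X + _]add_lfunE [X in _ + X]opp_lfunE !tens_mapE.
by rewrite !comp_lfunE.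
Qed.

(** Only products of mixed parity reach the odd part, and there K of the target reads off the
    v_0-coefficient of the odd factor. *)
Lemma spl_pi_odd_super_side p q : spl_pi_odd SC (super_side (p \ox q)) =
  spl_pi_odd SC (mu (EA p \ox KB q)) + spl_pi_odd SC (mu (KA p \ox EB q)).
Proof.
have [M ME] : exists M : 'Hom(rep_tens A B, C),
      forall t, spl_pi_odd SC (mu t) = M t.
  by exists (spl_pi_odd SC \o mu)%VF => t; rewrite comp_lfunE.
rewrite !ME.
have lc0 := @c0_linear F hF.
have e : (spl_pi_odd SC \o super_side = M \o (tens_map EA KB + tens_map KA EB))%VF.
  apply: tens_Fobj_ext => [x y|x y v|x u y|x u y v]; rewrite [RHS]comp_lfunE;
    rewrite [X in M X]add_lfunE !tens_mapE [LHS]comp_lfunE spl_pi_odd_super_sideE.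
  - rewrite Jrep_even_even /= linear0 [v0_part SC _]odd_part0.
    have [_ -> _] := parts_even x; have [_ -> _] := parts_even y.
    by rewrite tpure0l tpure0r addr0 linear0.
  - rewrite Jrep_even_odd /= tens_mapE id_lfunE; have [_ -> _ _] := mhomE mu SC x 0 0 y.
    rewrite [LHS]odd_part_tpure //.
    have [-> -> _] := parts_even x; have [-> -> _] := parts_odd y v.
    by rewrite tpure0l addr0 tpureZr linearZ /= -ME proj1E.
  - rewrite Jrep_odd_even /= tens_mapE id_lfunE; have [_ _ -> _] := mhomE mu SC 0 x y 0.
    rewrite [LHS]odd_part_tpure //.
    have [-> -> _] := parts_odd x u; have [-> -> _] := parts_even y.
    by rewrite tpure0l add0r tpureZl linearZ /= -ME proj1E.
  rewrite Jrep_odd_odd /= linear0 [v0_part SC _]odd_part0.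
  have [-> -> _] := parts_odd x u; have [-> -> _] := parts_odd y v.
  by rewrite tpure0l tpure0r addr0 linear0.
rewrite -[LHS]comp_lfunE e [LHS]comp_lfunE -linearD.
congr (M _).
by rewrite !add_lfunE !tens_mapE.
Qed.

Lemma spl_pi_coinvariant t : spl_pi0 SC (mu (delta _ t)) = 0 /\
  spl_pi_odd SC (mu (delta _ t)) = 0.
Proof. by rewrite delta_hom; have [-> -> _ _] := spl_pi_delta SC (mu t). Qed.

(** Special to the odd component, as C_0 itself consists of invariants. *)
Lemma spl_pi_odd_mu_invariant t : delta _ t = 0 -> spl_pi_odd SC (mu t) = 0.
Proof. by move=> dt0; apply: spl_pi_odd_invariant; rewrite -delta_hom dt0 linear0. Qed.

Local Notation rhs := (repComp mu (repHom_tens (iota_hom SA) (iota_hom SB))).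

Lemma defect_negligible (f : repHom (rep_tens FA FB) C) :
  (forall t, f t = super_side t - rhs t) -> f \in negligible (rep_tens FA FB) C.
Proof.
move=> fE.
have rE p q : rhs (p \ox q) = mu ((EA p + KA p + delta A (LA p)) \ox
                                   (EB q + KB q + delta B (LB q))).
  by rewrite comp_lfunE tens_mapE !iota_homE_parts.
have dA p : [/\ delta A (EA p) = 0, delta A (delta A (KA p)) = 0 &
    delta A (delta A (LA p)) = 0].
  have [eS kS lS] := parts_mem p.
  by rewrite (delta_spl0 eS) (delta_delta_odd kS) (delta_delta_odd lS).
have dB q : [/\ delta B (EB q) = 0, delta B (delta B (KB q)) = 0 &
    delta B (delta B (LB q)) = 0].
  have [eS kS lS] := parts_mem q.
  by rewrite (delta_spl0 eS) (delta_delta_odd kS) (delta_delta_odd lS).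
have dFA := parts_delta (S := SA); have dFB := parts_delta (S := SB).
have [dEA dKA dLA] : [/\ forall p, EA (delta FA p) = 0,
    forall p, KA (delta FA p) = 0 & forall p, LA (delta FA p) = KA p].
  by split=> p; have [] := dFA p.
have [dEB dKB dLB] : [/\ forall p, EB (delta FB p) = 0,
    forall p, KB (delta FB p) = 0 & forall p, LB (delta FB p) = KB p].
  by split=> p; have [] := dFB p.
(* By [tens_map_lower], [phi] after delta is - mu (K (x) (E + K) + E (x) K), the defect left by
   [addr_cancel]. *)
have [phi phiE] : exists phi : 'Hom(rep_tens FA FB, C), forall t,
    phi t = - mu (tens_map LA (EB + KB) t + tens_map EA LB t).
  exists (- (mu \o (tens_map LA (EB + KB) + tens_map EA LB)))%VF => t.
  by rewrite [LHS]opp_lfunE comp_lfunE [X in mu X]add_lfunE.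
(* By [tens_map_lower2], [psi] after delta^2 is 2 mu (K (x) K). *)
have [psi psiE] : exists psi : 'Hom(rep_tens FA FB, C), forall t,
    psi t = mu (tens_map LA LB t).
  by exists (mu \o tens_map LA LB)%VF => t; rewrite comp_lfunE.
have splB (pi : 'End(C)) x y : pi (x - y) = pi x - pi y by rewrite linearB.
have splN (pi : 'End(C)) x : pi (- x) = - pi x by rewrite linearN.
have MD (M : 'Hom(rep_tens A B, C)) x y : M (x + y) = M x + M y.
  by rewrite linearD.
apply: (negligible_splitting (S := SC) (phi := phi) (psi := psi)).
  have [M ME] : exists M : 'Hom(rep_tens A B, C),
      forall t, spl_pi0 SC (mu t) = M t.
    by exists (spl_pi0 SC \o mu)%VF => t; rewrite comp_lfunE.
  have Md t : M (delta _ t) = 0 by rewrite -ME (spl_pi_coinvariant t).1.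
  apply: tens_ext => p q; rewrite [LHS]comp_lfunE [RHS]comp_lfunE fE.
  have [e2 k2 l2] := dA p; have [e2' k2' l2'] := dB q.
  rewrite splB spl_pi0_super_side rE !ME (coinv_expand Md e2 k2 l2 e2' k2' l2').
  rewrite addr_cancel [(phi \o _)%VF _]comp_lfunE phiE splN ME.
  rewrite (tens_map_lower dEA dLA dEB dKB dLB).
  by rewrite !MD tpureDr MD [in RHS]addrC.
have [M ME] : exists M : 'Hom(rep_tens A B, C),
    forall t, spl_pi_odd SC (mu t) = M t.
  by exists (spl_pi_odd SC \o mu)%VF => t; rewrite comp_lfunE.
have Md t : M (delta _ t) = 0 by rewrite -ME (spl_pi_coinvariant t).2.
have Mk t : delta _ t = 0 -> M t = 0.
  by rewrite -ME; apply: spl_pi_odd_mu_invariant.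
apply: tens_ext => p q; rewrite [LHS]comp_lfunE [RHS]comp_lfunE fE.
have [e2 k2 l2] := dA p; have [e2' k2' l2'] := dB q.
rewrite splB spl_pi_odd_super_side rE !ME (coinv_expand Md e2 k2 l2 e2' k2' l2').
(* In the odd component the bracket and the even-even term vanish because [M] kills invariants; the
   mixed terms cancel against the super side. *)
rewrite (coinv_inv_odd Md hF Mk k2 l2') (coinv_inv_odd Md hF Mk l2 k2').
have -> : M (EA p \ox EB q) = 0.
  by apply: Mk; rewrite delta_tens e2 e2' !tpure0l tpure0r !addr0.
rewrite [(psi \o _)%VF _]comp_lfunE [X in psi X]comp_lfunE psiE ME.
rewrite (tens_map_lower2 dKA dLA dKB dLB) MD.
rewrite subrr addr0 add0r addrA opprD addrA subrr add0r.
(* What remains is - x = 2 x for x = M (K (x) K), which is 3 x = 0. *)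
set x := M _; apply/eqP; rewrite eq_sym -addr_eq0.
have -> : x + x + x = (1 + 1 + 1) *: x by rewrite !scalerDl !scale1r.
by rewrite pchar3_sum1 // scale0r.
Qed.

End Main.

Theorem theorem2p6 (F : fieldType) (hF : 3%N \in [pchar F])
    (A B C : rep F) (mu : repHom (rep_tens A B) C)
    (SA : splitting hF A) (SB : splitting hF B) (SC : splitting hF C) :
  verComp (verClass (iota_hom SC))
    (verComp (Fmor hF (mhom mu SA SB SC)) (Jmor hF (sspace SA) (sspace SB)))
  = verComp (verClass mu) (verClass (repHom_tens (iota_hom SA) (iota_hom SB))).
Proof.
(* All classes have explicit representatives, so the equation says that the difference of two
   composites in Rep C_3 is negligible. *)
rewrite /Fmor /Jmor !verCompE; apply/verClassP.
apply: (defect_negligible (mu := mu) (SA := SA) (SB := SB) (SC := SC)) => t.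
exact: repHom_subE.
Qed.
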